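(* Let $\zeta$ be a smooth harmonic unit vector field defined on all of $\mathbb{S}^3$ whose integral curves are great circles. Then $\zeta$ is a Hopf vector field.
   Context: $\mathbb{S}^3\subset\mathbb{R}^4$ carries the round metric with Levi-Civita connection $\nabla$. A unit vector field $\zeta$ is harmonic if $\Delta\zeta+|\nabla\zeta|^2\zeta=0$, where $\Delta\zeta=\operatorname{trace}\nabla^2\zeta$ is the rough Laplacian. A Hopf vector field on $\mathbb{S}^3$ is a vector field of the form $\zeta(p)=\mathcal{J}p$, where $\mathcal{J}$ is a linear map of $\mathbb{R}^4$ with $\mathcal{J}\in O(4)$ and $\mathcal{J}^2=-I$. *)

(* Defs.v *)
From HB Require Import structures.
From mathcomp Require Import all_boot all_order all_algebra.
From mathcomp Require Import all_classical all_reals all_analysis.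
Set Implicit Arguments. Unset Strict Implicit. Unset Printing Implicit Defensive.
Import Order.TTheory GRing.Theory Num.Theory.
Import numFieldNormedType.Exports.
Local Open Scope classical_set_scope.
Local Open Scope ring_scope.

Section Defs.
Variable R : realType.
Notation V := 'rV[R]_4.

Definition dot (u v : V) : R := (u *m v^T) 0 0.

Definition S3 (p : V) : Prop := dot p p = 1.

Definition tproj (p w : V) : V := w - dot w p *: p.

(* Levi-Civita connection of the round S^3, computed extrinsically:
   (nabla_X Y)(p) = tangential part of the Euclidean directional
   derivative of Y at p in direction X p. *)
Definition nabla (X Y : V -> V) : V -> V := fun p => tproj p ('D_(X p) Y p).

Definition vec4 (a b c d : R) : V := \row_(i < 4) [:: a; b; c; d]`_i.

(* Global orthonormal frame of T S^3: quaternionic left multiplication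
   of p = a + b i + c j + d k by i, j, k. *)
Definition frame (k : 'I_3) (p : V) : V :=
  let a := p 0 0 in let b := p 0 1 in let c := p 0 2 in let d := p 0 3 in
  match val k with
  | 0 => vec4 (- b) a (- d) c
  | 1 => vec4 (- c) d a (- b)
  | _ => vec4 (- d) (- c) b a
  end.

Definition rough_laplacian (z : V -> V) : V -> V := fun p =>
  \sum_(k < 3) (nabla (frame k) (nabla (frame k) z) p
                - nabla (nabla (frame k) (frame k)) z p).

Definition nabla_sqnorm (z : V -> V) (p : V) : R :=
  \sum_(k < 3) dot (nabla (frame k) z p) (nabla (frame k) z p).

Definition iter_deriv (vs : seq V) (f : V -> V) : V -> V :=
  foldr (fun v g => fun x => 'D_v g x) f vs.
Definition smooth_field (f : V -> V) : Prop :=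
  forall (vs : seq V) (x : V), differentiable (iter_deriv vs f) x.

Definition unit_vector_field (z : V -> V) : Prop :=
  forall p, S3 p -> dot (z p) p = 0 /\ dot (z p) (z p) = 1.

Definition harmonic_field (z : V -> V) : Prop :=
  forall p, S3 p -> rough_laplacian z p + nabla_sqnorm z p *: z p = 0.

Definition integral_curve (z : V -> V) (g : R -> V) : Prop :=
  forall t, S3 (g t) /\ is_derive t (1 : R) g (z (g t)).

Definition great_circle (C : set V) : Prop :=
  exists u v : V, [/\ dot u u = 1, dot v v = 1, dot u v = 0 &
    C = [set cos s *: u + sin s *: v | s in [set: R]]].

Definition integral_curves_great_circles (z : V -> V) : Prop :=
  forall g : R -> V, integral_curve z g -> great_circle (range g).

Definition hopf (z : V -> V) : Prop :=
  exists J : 'M[R]_4, [/\ J *m J^T = 1%:M, J *m J = - 1%:M &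
    forall p, S3 p -> z p = (J *m p^T)^T].

End Defs.

(* Main.v *)
Require Import Defs.
From HB Require Import structures.
From mathcomp Require Import all_boot all_order all_algebra.
From mathcomp Require Import all_classical all_reals all_analysis.
From mathcomp Require Import ring lra.
Set Implicit Arguments. Unset Strict Implicit. Unset Printing Implicit Defensive.
Import Order.TTheory GRing.Theory Num.Theory.
Import numFieldNormedType.Exports.
Local Open Scope classical_set_scope.
Local Open Scope ring_scope.

(** Split the bivector p /\ z(p) of R^4 into its self-dual and
    anti-self-dual parts; this gives two Gauss maps a, b : S^3 -> S^2, constant
    along the leaves, and z is Hopf as soon as one of them is constant.

    Since the leaves are great circles, <a(p), a(q)> - <b(p), b(q)> is twice
    det(p, z(p), q, z(q)), which vanishes only if p and q lie on one leaf. Off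
    the leaves it has a constant sign, so (up to exchanging a and b)
    |a(p) - a(q)| <= |b(p) - b(q)|. Hence b has rank 2 everywhere, so it takes
    two antipodal values b(p1) = - b(p2), and then <a(p1) + a(p2), a> > 0 on S^3:
    the image of a lies in an open hemisphere.

    The curl of a unit geodesic field is parallel to the field; therefore z is
    a harmonic section if and only if a and b are harmonic maps to S^2. The
    positive function h = <a(p1) + a(p2), a> satisfies Delta h = - |da|^2 h <= 0,
    so by the maximum principle da = 0.

    The hypothesis on integral curves only has content because integral curves
    exist; they are obtained by Picard iteration. *)

(** The parameter e = 1 or -1 treats both Gauss maps by the same polynomial formulas; the sign d of
    the determinant then decides which of them is called a. The sign is constant because the
    complement of a circle in S^3 is connected, which is made concrete by moving points along great
    circles that avoid the leaf. The rank of b comes from two facts: da and db cannot both kill a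
    direction w normal to the leaf, since the bivector w /\ z + p /\ D_w z is nonzero, and the
    contraction makes da(w) vanish as soon as db(w) does. The antipodal value needs no degree
    theory: at a minimum p2 of <b(p1), b> on the compact sphere, rank 2 forces b(p2) = b(p1) or
    b(p2) = - b(p1), and the first would make b constant. The p1 and p2 contributions of b then
    cancel in <a(p1) + a(p2), a>, leaving two determinants of one sign that cannot both vanish. *)

Section Calculus.
Context {R : realType}.
Notation V := 'rV[R]_4.
Implicit Types (c g : R -> V) (f : R -> R) (t s : R) (p q v w : V).

(** * Coordinates in R^4 and derivatives of curves *)

Lemma forall_I4 (P : 'I_4 -> Prop) : P 0 -> P 1 -> P 2 -> P 3 -> forall i, P i.
Proof.
move=> P0 P1 P2 P3 [[|[|[|[|//]]]] lti].
- by rewrite (_ : Ordinal lti = 0)//; exact/val_inj.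
- by rewrite (_ : Ordinal lti = 1)//; exact/val_inj.
- by rewrite (_ : Ordinal lti = 2)//; exact/val_inj.
- by rewrite (_ : Ordinal lti = 3)//; exact/val_inj.
Qed.

Lemma forall_I3 (P : 'I_3 -> Prop) : P 0 -> P 1 -> P 2 -> forall i, P i.
Proof.
move=> P0 P1 P2 [[|[|[|//]]] lti].
- by rewrite (_ : Ordinal lti = 0)//; exact/val_inj.
- by rewrite (_ : Ordinal lti = 1)//; exact/val_inj.
- by rewrite (_ : Ordinal lti = 2)//; exact/val_inj.
Qed.

Lemma sum_I4 (W : nmodType) (F : 'I_4 -> W) :
  \sum_i F i = F 0 + F 1 + F 2 + F 3.
Proof.
rewrite !big_ord_recl big_ord0 addr0 !addrA.
by congr (F _ + F _ + F _ + F _); exact/val_inj.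
Qed.

Lemma sum_I3 (W : nmodType) (F : 'I_3 -> W) : \sum_i F i = F 0 + F 1 + F 2.
Proof.
rewrite !big_ord_recl big_ord0 addr0 !addrA.
by congr (F _ + F _ + F _); exact/val_inj.
Qed.

Lemma row4P (x y : V) : x 0 0 = y 0 0 -> x 0 1 = y 0 1 -> x 0 2 = y 0 2 ->
  x 0 3 = y 0 3 -> x = y.
Proof. by move=> *; apply/rowP; apply: forall_I4. Qed.

Lemma dotE (x y : V) : dot x y =
  x 0 0 * y 0 0 + x 0 1 * y 0 1 + x 0 2 * y 0 2 + x 0 3 * y 0 3.
Proof. by rewrite /dot mxE sum_I4 !mxE. Qed.

Lemma dotC (x y : V) : dot x y = dot y x.
Proof. by rewrite !dotE; ring. Qed.

Lemma is_derive_comp_curve (W : normedModType R) (f : V -> W) c t v :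
  differentiable f (c t) -> is_derive t 1 c v ->
  is_derive t 1 (fun s => f (c s)) ('D_v f (c t)).
Proof.
move=> df [dc <-].
have dc' : differentiable c t by exact/derivable1_diffP.
have dfc : differentiable (f \o c) t by exact: differentiable_comp.
apply: DeriveDef; first exact: diff_derivable.
rewrite (_ : (fun s => f (c s)) = f \o c)// !deriveE// diff_comp//=.
Qed.

Lemma is_derive_coord c t v (j : 'I_4) :
  is_derive t 1 c v -> is_derive t 1 (fun s => c s 0 j) (v 0 j).
Proof.
move=> [dc <-]; apply: DeriveDef; first exact: (derivable_mxP c t 1).1.
by rewrite derive_mx// mxE.
Qed.

Lemma is_derive_row c t v :
  (forall j, is_derive t 1 (fun s => c s 0 j) (v 0 j)) -> is_derive t 1 c v.
Proof.
move=> dc; have dc' : derivable c t 1.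
  by apply/derivable_mxP => i j; rewrite ord1; exact: ex_derive.
apply: DeriveDef => //; rewrite derive_mx//; apply/rowP => j; rewrite mxE.
exact: derive_val.
Qed.

Lemma is_derive_scalel f t (a : R) v : is_derive t 1 f a ->
  is_derive t 1 (fun s => f s *: v) (a *: v).
Proof.
move=> df; apply: is_derive_row => j; rewrite mxE mulrC.
under eq_fun do rewrite mxE mulrC.
exact: (@is_deriveZ _ _ _ f (v 0 j) t 1 a df).
Qed.

Lemma is_derive_scale f c t (a : R) v : is_derive t 1 f a -> is_derive t 1 c v ->
  is_derive t 1 (fun s => f s *: c s) (a *: c t + f t *: v).
Proof.
move=> df dc; apply: is_derive_row => j; rewrite !mxE.
under eq_fun do rewrite mxE.
have dj := is_derive_coord j dc.
by apply: is_derive_eq; rewrite /GRing.scale/=; ring.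
Qed.

Lemma is_derive_dot c g t v w : is_derive t 1 c v -> is_derive t 1 g w ->
  is_derive t 1 (fun s => dot (c s) (g s)) (dot v (g t) + dot (c t) w).
Proof.
move=> dc dg; under eq_fun do rewrite dotE; rewrite !dotE.
have dC j := is_derive_coord j dc; have dG j := is_derive_coord j dg.
apply: is_derive_eq; rewrite /GRing.scale/=; ring.
Qed.

Lemma is_derive_unique (W : normedModType R) (f : R -> W) t (a b : W) :
  is_derive t 1 f a -> is_derive t 1 f b -> a = b.
Proof. by move=> [_ <-] [_ <-]. Qed.

Lemma is_derive_continuous (W : normedModType R) (f : R -> W) t (a : W) :
  is_derive t 1 f a -> {for t, continuous f}.
Proof. by move=> [df _]; exact/differentiable_continuous/derivable1_diffP. Qed.

Lemma is_derive_cst_V c : (forall t, is_derive t 1 c 0) -> forall t, c t = c 0.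
Proof.
move=> dc t; apply/rowP => j.
apply: (@is_derive_0_is_cst _ (fun s => c s 0 j)) => s.
by have := is_derive_coord j (dc s); rewrite mxE.
Qed.

(** * One-variable calculus: mean values, primitives, minima *)

Lemma MVT_le (f g df dg : R -> R) (a b : R) : a <= b ->
  (forall t, is_derive t 1 f (df t)) -> (forall t, is_derive t 1 g (dg t)) ->
  (forall t, a <= t <= b -> df t <= dg t) -> f b - f a <= g b - g a.
Proof.
move=> ab Df Dg le_d.
have dh t : is_derive t 1 (g \- f) (dg t - df t).
  exact: is_deriveB.
have [|c] := @MVT_segment R (g \- f) (fun t => dg t - df t) a b ab (fun t _ => dh t).
  apply: continuous_subspaceT => t; exact: is_derive_continuous (dh t).
rewrite in_itv/= => /le_d + E; rewrite -subr_ge0 => Hc.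
have : 0 <= (g \- f) b - (g \- f) a by rewrite E mulr_ge0// subr_ge0.
by rewrite /=; lra.
Qed.

(* The primitive over [-1, x] is differentiable for x > -1 only; the mirror
   image covers x < 1. *)
Lemma exists_primitive f : continuous f ->
  exists2 F : R -> R, F 0 = 0 & forall t, is_derive t 1 F (f t).
Proof.
have half (h : R -> R) : continuous h ->
    exists F : R -> R, forall t, -1 < t -> is_derive t 1 F (h t).
  move=> ch; exists (fun x => (\int[lebesgue_measure]_(t in `[-1, x]) h t)%R).
  move=> t t1.
  have tt : t < t + 1 by rewrite ltrDl.
  have ih : lebesgue_measure.-integrable `[-1, t + 1] (EFin \o h).
    apply: continuous_compact_integrable; first exact: segment_compact.
    exact: continuous_subspaceT.
  have [d1 d2] := @continuous_FTC1_closed R h (-1) t (t + 1) tt ih t1 (ch t).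
  by apply: DeriveDef; [exact: d1 | rewrite -derive1E; exact: d2].
move=> cf; have [G0 dG0] := half _ cf.
have cfN : continuous (fun s => f (- s)).
  by move=> s; apply: continuous_comp; [exact: opp_continuous|exact: cf].
have [H0 dH0] := half _ cfN.
pose G t := G0 t - G0 0; pose H t := - (H0 (- t) - H0 0).
have dG t : -1 < t -> is_derive t 1 G (f t).
  move=> t1; have := dG0 _ t1 => d.
  rewrite /G; have -> : f t = f t - 0 by rewrite subr0.
  by apply: is_deriveB.
have dH t : t < 1 -> is_derive t 1 H (f t).
  move=> t1; have t1' : -1 < - t by rewrite ltrN2.
  have := dH0 _ t1'; rewrite opprK => d.
  have d' : is_derive t 1 (H0 \o -%R) (-1 * f t).
    have dN : is_derive t 1 (-%R : R -> R) (-1) by exact: is_deriveNid.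
    rewrite mulrC; exact: (@is_derive1_comp _ H0 -%R t (f t) (-1)).
  have d'' : is_derive t 1 (fun t => H0 (- t) - H0 0) (-1 * f t - 0).
    by apply: is_deriveB.
  rewrite /H (_ : f t = - (-1 * f t - 0)); last by rewrite subr0 mulN1r opprK.
  exact: is_deriveN.
have GH t : -1 < t < 1 -> G t = H t.
  move=> t11.
  have H00 : H 0 = 0 by rewrite /H oppr0 subrr oppr0.
  have G00 : G 0 = 0 by rewrite /G subrr.
  have main (a b : R) : -1 < a -> a <= b -> b < 1 -> G a - H a = G b - H b.
    move=> a1 ab b1.
    have dd (x : R) : -1 < x < 1 -> is_derive x 1 (G \- H) (f x - f x).
      by move=> /andP[? ?]; apply: is_deriveB; [exact: dG|exact: dH].
    have [||c _] := @MVT_segment R (G \- H) (fun x => f x - f x) a b ab.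
    - by move=> x; rewrite in_itv/= => /andP[? ?]; apply: dd; lra.
    - apply: continuous_in_subspaceT => x; rewrite inE/= in_itv/= => /andP[? ?].
      apply: is_derive_continuous; apply: dd; lra.
    - by rewrite /= subrr mul0r => /subr0_eq.
  have [t0|t0] := leP 0 t.
    by have := main 0 t; rewrite G00 H00; lra.
  by have := main t 0; rewrite G00 H00; lra.
exists (fun t => if 0 < t then G t else H t).
  by rewrite ltxx /H oppr0 subrr oppr0.
move=> t; have [t0|t0] := ltP 0 t.
  apply: (@near_eq_is_derive _ _ _ G) (dG t _); rewrite ?oner_neq0//; last by lra.
  by near=> x; rewrite ifT//; near: x; exact: lt_nbhsr.
apply: (@near_eq_is_derive _ _ _ H) (dH t _); rewrite ?oner_neq0//; last by lra.
near=> x; case: ifPn => // x0; rewrite GH// (lt_trans _ x0) ?ltrN10//=.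
by near: x; apply: lt_nbhsl; lra.
Unshelve. all: by end_near. Qed.

Lemma derivative_at_min f (df : R -> R) :
  (forall t : R, is_derive t 1 f (df t)) -> (forall t, f 0 <= f t) -> df 0 = 0.
Proof.
move=> Df fmin.
have i0 : (0 : R) \in `]-1, 1[%R by rewrite in_itv/= ltrN10 ltr01.
apply: (is_derive_unique (Df 0)).
have m11 : (-1 : R) <= 1 by rewrite (le_trans (lerN10 _)) ?ler01.
have ex t : t \in `]-1, 1[%R -> derivable f t 1 by move=> _; have [] := Df t.
exact: (derive1_at_min m11 ex i0).
Qed.

(** Were [d2] negative, [df] would be negative just to the right of 0, and the mean value theorem
    would put [f] there below [f 0]. *)
Lemma second_derivative_at_min f (df : R -> R) (d2 : R) :
  (forall t : R, is_derive t 1 f (df t)) -> is_derive (0 : R) 1 df d2 ->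
  (forall t, f 0 <= f t) -> 0 <= d2.
Proof.
move=> Df D2 fmin; have df0 := derivative_at_min Df fmin.
rewrite leNgt; apply/negP => d2neg.
have [/cvg_ex[/= l Hl] lim2] := D2.
have El : l = d2 by rewrite -lim2; apply/esym/cvg_lim.
move: Hl; rewrite El => /cvgrPdist_lt /(_ (- d2)).
rewrite oppr_gt0 => /(_ d2neg).
move=> [e /= e0 He].
have neg x : 0 < x < e -> df x < 0.
  move=> /andP[x0 xe].
  have := He x; rewrite /ball_/= sub0r normrN gtr0_norm// => /(_ xe).
  rewrite gt_eqF// => /(_ isT); rewrite df0 subr0 addr0 /GRing.scale/= mulr1.
  rewrite ltr_norml => /andP[+ _].
  rewrite ltrBrDl ltrBlDl => H.
  have {H} : x^-1 * df x < 0 by lra.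
  by rewrite pmulr_rlt0// invr_gt0.
have e20 : 0 < e / 2 by rewrite divr_gt0.
have cf : {within `[0, e / 2], continuous f}.
  by apply: continuous_subspaceT => t; exact: is_derive_continuous (Df t).
have [c] := @MVT R f df 0 (e / 2) e20 (fun x _ => Df x) cf.
rewrite in_itv/= subr0 => /andP[c0 ce] E.
have /neg cn : 0 < c < e by rewrite c0/=; lra.
have := fmin (e / 2); rewrite -subr_ge0 E pmulr_lge0// leNgt cn.
by [].
Qed.

(* Lagrange: |N|^2 v - <N, v> N = (v . y) N x B - (v . B) N x y, N = B x y. *)
Lemma parallel_cross (b0 b1 b2 y0 y1 y2 v0 v1 v2 : R) :
  let n0 := b1 * y2 - b2 * y1 in let n1 := b2 * y0 - b0 * y2 in
  let n2 := b0 * y1 - b1 * y0 in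
  b0 * v0 + b1 * v1 + b2 * v2 = 0 -> y0 * v0 + y1 * v1 + y2 * v2 = 0 ->
  let nn := n0 * n0 + n1 * n1 + n2 * n2 in
  let nv := n0 * v0 + n1 * v1 + n2 * v2 in
  [/\ nn * v0 = nv * n0, nn * v1 = nv * n1 & nn * v2 = nv * n2].
Proof.
move=> n0 n1 n2 bv yv nn nv; split; apply/eqP; rewrite -subr_eq0; apply/eqP.
- transitivity ((y0 * v0 + y1 * v1 + y2 * v2) * (n1 * b2 - n2 * b1)
    - (b0 * v0 + b1 * v1 + b2 * v2) * (n1 * y2 - n2 * y1)).
    by rewrite /nn /nv /n0 /n1 /n2; ring.
  by rewrite bv yv; ring.
- transitivity ((y0 * v0 + y1 * v1 + y2 * v2) * (n2 * b0 - n0 * b2)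
    - (b0 * v0 + b1 * v1 + b2 * v2) * (n2 * y0 - n0 * y2)).
    by rewrite /nn /nv /n0 /n1 /n2; ring.
  by rewrite bv yv; ring.
- transitivity ((y0 * v0 + y1 * v1 + y2 * v2) * (n0 * b1 - n1 * b0)
    - (b0 * v0 + b1 * v1 + b2 * v2) * (n0 * y1 - n1 * y0)).
    by rewrite /nn /nv /n0 /n1 /n2; ring.
  by rewrite bv yv; ring.
Qed.

(** If a linear map sends two vectors into one line, with coefficients [l] and [m], a combination
    orthogonal to (l, m) is in its kernel. The factor [n] stays on both sides so that it can be
    cancelled afterwards; [s] normalises the combination. *)
Lemma combination_eq0 (a b s n X Y l m t : R) : n * X = l * t -> n * Y = m * t ->
  a * l + b * m = 0 -> n * (a / s * X + b / s * Y) = n * 0.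
Proof.
move=> HX HY lm; transitivity ((a * (n * X) + b * (n * Y)) / s); first by ring.
by rewrite HX HY; transitivity ((a * l + b * m) * t / s); [ring|rewrite lm; ring].
Qed.

(** Dividing the inequality by t^2 and letting t tend to 0 leaves a^2 <= 0. This carries a vanishing
    derivative through the contraction between the Gauss maps. *)
Lemma derive_le_sqr (f : R -> R) (g : 'I_3 -> R -> R) (a : R) :
  f 0 = 0 -> (forall k, g k 0 = 0) ->
  is_derive (0 : R) 1 f a -> (forall k, is_derive (0 : R) 1 (g k) 0) ->
  (forall t, f t * f t <= \sum_k g k t * g k t) -> a = 0.
Proof.
move=> f0 g0 df dg le_fg.
have quot (h : R -> R) b : h 0 = 0 -> is_derive (0 : R) 1 h b ->
    (t^-1 * h t) @[t --> 0^'] --> b.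
  move=> h0 [/cvg_ex[/= l Hl] <-].
  have -> : 'D_1 h 0 = l by apply/cvg_lim.
  apply: cvg_trans Hl; apply: near_eq_cvg; near=> t.
  by rewrite h0 subr0 addr0 /GRing.scale/= mulr1.
have qf := quot _ _ f0 df; have qg k := quot _ _ (g0 k) (dg k).
have L : (t^-1 * f t) * (t^-1 * f t) @[t --> 0^'] --> a * a by exact: cvgM.
have G k : (t^-1 * g k t) * (t^-1 * g k t) @[t --> 0^'] --> (0 : R) * 0.
  exact: cvgM.
have S : ((t^-1 * g 0 t) * (t^-1 * g 0 t) + (t^-1 * g 1 t) * (t^-1 * g 1 t)
    + (t^-1 * g 2 t) * (t^-1 * g 2 t)) @[t --> 0^'] --> (0 : R) * 0 + 0 * 0 + 0 * 0.
  by apply: cvgD; [apply: cvgD|]; exact: G.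
have : a * a <= 0 * 0 + 0 * 0 + 0 * 0.
  apply: (ler_cvg_to L S); near=> t.
  have -> : t^-1 * f t * (t^-1 * f t) = (t^-1 * t^-1) * (f t * f t) by ring.
  have -> : t^-1 * g 0 t * (t^-1 * g 0 t) + t^-1 * g 1 t * (t^-1 * g 1 t) +
    t^-1 * g 2 t * (t^-1 * g 2 t) = (t^-1 * t^-1) * \sum_k g k t * g k t.
    by rewrite sum_I3; ring.
  by rewrite ler_wpM2l// -expr2 sqr_ge0.
rewrite mulr0 !addr0 -expr2 => a0; apply/eqP; rewrite -sqrf_eq0 eq_le a0.
exact: sqr_ge0.
Unshelve. all: by end_near. Qed.

End Calculus.

(** * Continuity of algebraic expressions in continuous maps *)

Section Continuity.
Context {R : realType}.
Notation V := 'rV[R]_4.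

Lemma continuous_coord (f : V -> V) j :
  continuous f -> continuous (fun x => f x 0 j).
Proof.
by move=> cf x; exact: (continuous_comp (cf x) (@coord_continuous _ _ _ 0 j _)).
Qed.

Lemma continuous_add (T : topologicalType) (f g : T -> R) :
  continuous f -> continuous g -> continuous (fun t => f t + g t).
Proof. by move=> cf cg t; apply: cvgD; [exact: cf|exact: cg]. Qed.

Lemma continuous_opp (T : topologicalType) (f : T -> R) :
  continuous f -> continuous (fun t => - f t).
Proof. by move=> cf t; apply: cvgN; exact: cf. Qed.

Lemma continuous_mul (T : topologicalType) (f g : T -> R) :
  continuous f -> continuous g -> continuous (fun t => f t * g t).
Proof. by move=> cf cg t; apply: cvgM; [exact: cf|exact: cg]. Qed.

Lemma continuous_dot (f g : V -> V) : continuous f -> continuous g ->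
  continuous (fun x => dot (f x) (g x)).
Proof.
move=> cf cg; rewrite (_ : (fun x => dot (f x) (g x)) = fun x =>
    f x 0 0 * g x 0 0 + f x 0 1 * g x 0 1 + f x 0 2 * g x 0 2
    + f x 0 3 * g x 0 3); last by apply/funext => x; rewrite dotE.
have P j : continuous (fun x => f x 0 j * g x 0 j).
  by apply: continuous_mul; exact: continuous_coord.
exact: (continuous_add (continuous_add (continuous_add (P 0) (P 1)) (P 2)) (P 3)).
Qed.

Lemma continuous_sum3 (f : 'I_3 -> V -> R) :
  (forall k, continuous (f k)) -> continuous (fun p => \sum_k f k p).
Proof.
move=> cf; rewrite (_ : (fun p => _) = fun p => f 0 p + f 1 p + f 2 p); last first.
  by apply/funext => p; rewrite sum_I3.
exact: continuous_add (continuous_add (cf 0) (cf 1)) (cf 2).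
Qed.

Lemma continuous_scale (T : topologicalType) (W : normedModType R)
  (f : T -> R) (g : T -> W) : continuous f -> continuous g ->
  continuous (fun t => f t *: g t).
Proof. by move=> cf cg t; apply: cvgZ; [exact: cf|exact: cg]. Qed.

Lemma continuous_addv (T : topologicalType) (W : normedModType R) (f g : T -> W) :
  continuous f -> continuous g ->
  continuous (fun t => f t + g t).
Proof. by move=> cf cg t; apply: cvgD; [exact: cf|exact: cg]. Qed.

End Continuity.

(** * Global solutions of Lipschitz differential equations *)

Section Picard.
Context {R : realType}.
Notation V := 'rV[R]_4.

Lemma le_norm_row (v : V) (r : R) :
  0 <= r -> (forall j, `|v 0 j| <= r) -> `|v| <= r.
Proof.
move=> r0 vr; rewrite [leLHS]/Num.Def.normr/= mx_normrE.
by apply: bigmax_le => // -[i j] _; rewrite ord1.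
Qed.

Lemma norm_coord_le (v : V) j : `|v 0 j| <= `|v|.
Proof.
rewrite [leRHS]/Num.Def.normr/= mx_normrE.
exact: (le_bigmax _ (fun i => `|v i.1 i.2|) (ord0, j)).
Qed.

(** The norm of rows is the sup norm, so a scalar comparison in each coordinate suffices; negative
    times are reflected. A linear [phi] gives Lipschitz bounds, an exponential one gives the
    convergence of the Picard iterates. *)
Lemma growth_bound (c c' : R -> V) (phi phi' : R -> R) :
  c 0 = 0 -> (forall t : R, is_derive t 1 c (c' t)) ->
  (forall t : R, is_derive t 1 phi (phi' t)) ->
  (forall t, `|c' t| <= phi' `|t|) ->
  forall t, `|c t| <= phi `|t| - phi 0.
Proof.
move=> c0 dc dphi le_c' t.
have scalar (f f' : R -> R) : f 0 = 0 -> (forall t : R, is_derive t 1 f (f' t)) ->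
    (forall t, `|f' t| <= phi' `|t|) -> forall t, 0 <= t ->
    `|f t| <= phi t - phi 0.
  move=> f0 df le_f' s s0; rewrite ler_norml; apply/andP; split.
    rewrite lerNl; have := @MVT_le _ (fun t => - f t) phi (fun t => - f' t) phi' 0 s s0.
    rewrite f0 oppr0 subr0; apply => // x /andP[x0 _].
    by have := le_f' x; rewrite (ger0_norm x0) ler_norml; lra.
  have := @MVT_le _ f phi f' phi' 0 s s0.
  rewrite f0 subr0; apply => // x /andP[x0 _].
  by have := le_f' x; rewrite (ger0_norm x0) ler_norml; lra.
have coord j : `|c t 0 j| <= phi `|t| - phi 0.
  have dj (s : R) := is_derive_coord j (dc s).
  have lej (s : R) : `|c' s 0 j| <= phi' `|s| by rewrite (le_trans (norm_coord_le _ _)).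
  have [t0|t0] := leP 0 t.
    by rewrite (ger0_norm t0); apply: (scalar _ _ _ dj lej); rewrite ?c0 ?mxE.
  have dN (s : R) : is_derive s 1 (fun s => c (- s) 0 j) (- (c' (- s) 0 j)).
    have dN : is_derive s 1 (-%R : R -> R) (-1) by exact: is_deriveNid.
    rewrite -mulrN1; exact: (@is_derive1_comp _ (fun s => c s 0 j) -%R s _ (-1)).
  rewrite (ltr0_norm t0) -[X in c X 0 j]opprK.
  apply: (scalar (fun s => c (- s) 0 j) (fun s => - (c' (- s) 0 j))) => //.
  - by rewrite oppr0 c0 mxE.
  - by move=> s; rewrite normrN -(normrN s).
  - by lra.
by apply: le_norm_row => //; apply: le_trans (coord 0).
Qed.

(** The intervals of radius 2 K / 2^n around [u n] are nested, because consecutive radii differ by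
    exactly the allowed step K / 2^n. The limit is the supremum of the left endpoints. *)
Lemma geometric_limit (u : nat -> R) (K : R) :
  (forall n, `|u n.+1 - u n| <= K / 2 ^+ n) ->
  exists l, forall n, `|l - u n| <= 2 * K / 2 ^+ n.
Proof.
move=> uK; pose e n : R := 2 * K / 2 ^+ n.
have eS n : e n - e n.+1 = K / 2 ^+ n.
  by rewrite /e exprS; field; rewrite expf_neq0// pnatr_eq0.
have e0 n : 0 <= e n.
  have K0 : 0 <= K by have := uK 0%N; rewrite expr0 divr1; apply: le_trans.
  by rewrite /e mulr_ge0 ?mulr_ge0// invr_ge0 exprn_ge0.
pose a n := u n - e n; pose b n := u n + e n.
have aS n : a n <= a n.+1.
  by have := uK n; rewrite ler_norml -eS /a; lra.
have bS n : b n.+1 <= b n.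
  by have := uK n; rewrite ler_norml -eS /b; lra.
have amono : {homo a : m n / (m <= n)%N >-> m <= n}.
  by apply: homo_leq => //; exact: le_trans.
have bmono m n : (m <= n)%N -> b n <= b m.
  elim: n => [|n IH]; first by rewrite leqn0 => /eqP ->.
  by rewrite leq_eqVlt ltnS => /predU1P[->//|/IH]; apply: le_trans.
have ab m n : a m <= b n.
  apply: (le_trans (amono _ _ (leq_maxl m n))).
  apply: le_trans (bmono _ _ (leq_maxr m n)).
  by have := e0 (maxn m n); rewrite /a /b; lra.
have hs : has_sup (range a).
  by split; [exists (a 0%N), 0%N|exists (b 0%N) => _ [m _ <-]].
exists (sup (range a)) => n; rewrite ler_norml; apply/andP; split.
  have : a n <= sup (range a) by apply: ub_le_sup; [exact: hs.2|exists n].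
  by rewrite /a /e; lra.
have : sup (range a) <= b n by apply: ge_sup; [exact: hs.1|move=> _ [m _ <-]].
by rewrite /b /e; lra.
Qed.

Lemma le_of_geometric (x y K : R) :
  (forall n, x <= y + K / 2 ^+ n) -> x <= y.
Proof.
move=> H; apply/ler_addgt0Pr => e e0.
have [n Hn] : exists n, `|K / e| < n%:R.
  by exists (Num.bound `|K / e|); exact: archi_boundP.
have n2 : n%:R <= 2 ^+ n :> R by rewrite -natrX ler_nat ltnW// ltn_expl.
apply: (le_trans (H n)); rewrite lerD2l ler_pdivrMr ?exprn_gt0//.
rewrite -ler_pdivrMl// mulrC (le_trans (ler_norm _))// (le_trans (ltW Hn))//.
Qed.

Lemma lipschitz_continuous (U W : normedModType R) (f : U -> W) (L : R) :
  0 <= L -> (forall x y, `|f x - f y| <= L * `|x - y|) -> continuous f.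
Proof.
move=> L0 fL x; apply/cvgrPdist_le => e e0.
have L1 : 0 < L + 1 by rewrite ltr_wpDl.
have e1 : 0 < (L + 1)^-1 * e by rewrite mulr_gt0// invr_gt0.
near=> y.
apply: (le_trans (fL _ _)); apply: (@le_trans _ _ ((L + 1) * `|x - y|)).
  by rewrite ler_wpM2r// lerDl.
rewrite -ler_pdivlMl//.
Unshelve. all: by end_near. Qed.

Lemma is_derive_translate (W : normedModType R) (f : R -> W) (r s : R) (a : W) :
  is_derive (r + s) 1 f a -> is_derive r 1 (fun x => f (x + s)) a.
Proof.
have E : (fun h : R => h^-1 *: (f (h *: 1 + r + s) - f (r + s))) =
         (fun h : R => h^-1 *: (f (h *: 1 + (r + s)) - f (r + s))).
  by apply/funext => h; rewrite addrA.
by move=> [df <-]; apply: DeriveDef; rewrite /derivable /derive /= E.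
Qed.

(** With the weight exp(2 L |t|), integrating a difference multiplied by L gains the factor L / (2
    L) = 1/2. The iteration thus contracts on the whole line at once, and no local solutions have to
    be glued. *)
Lemma picard (F : V -> V) (M L : R) (p : V) : 0 < L ->
  (forall x, `|F x| <= M) -> (forall x y, `|F x - F y| <= L * `|x - y|) ->
  exists2 g : R -> V, g 0 = p & forall t : R, is_derive t 1 g (F (g t)).
Proof.
move=> L0 FM FL.
have M0 : 0 <= M by exact: le_trans (FM 0).
have cF : continuous F.
  exact: lipschitz_continuous (ltW L0) FL.
have prim (c : R -> V) : continuous c ->
    exists2 g : R -> V, g 0 = p & forall t : R, is_derive t 1 g (F (c t)).
  move=> cc.
  have /choice[P HP] j : exists P : R -> R,
      P 0 = 0 /\ forall t : R, is_derive t 1 P (F (c t) 0 j).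
    have [P P0 dP] := @exists_primitive _ (fun t => F (c t) 0 j)
      (fun t => continuous_comp (continuous_comp (cc t) (cF _))
         (@coord_continuous _ _ _ 0 j _)).
    by exists P.
  exists (fun t => p + \row_j P j t).
    by apply/rowP => j; rewrite !mxE (HP j).1 addr0.
  move=> t; apply: is_derive_row => j.
  under eq_fun do rewrite !mxE.
  have := (HP j).2 t => d; rewrite -[X in is_derive _ _ _ X]add0r.
  exact: is_deriveD.
have cder (c c' : R -> V) : (forall t : R, is_derive t 1 c (c' t)) -> continuous c.
  by move=> d t; exact: is_derive_continuous (d t).
(* To be iterated, [step] must be total; on a discontinuous curve it takes the junk value 0. *)
have [step Hstep] : exists step : (R -> V) -> R -> V, forall c, continuous c ->
    step c 0 = p /\ forall t : R, is_derive t 1 (step c) (F (c t)).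
  have /choice[step H] : forall c : R -> V, exists g : R -> V, continuous c ->
      g 0 = p /\ forall t : R, is_derive t 1 g (F (c t)).
    move=> c; have [/prim[g g0 dg]|nc] := pselect (continuous c).
      by exists g.
    by exists (fun=> 0) => /nc.
  by exists step.
pose it n := iter n step (fun=> p).
have cit n : continuous (it n).
  elim: n => [|n IH]; first exact: cst_continuous.
  exact: cder (Hstep _ IH).2.
have it0 n : it n 0 = p by case: n => [//|n]; exact: (Hstep _ (cit n)).1.
have dit n (t : R) : is_derive t 1 (it n.+1) (F (it n t)).
  exact: (Hstep _ (cit n)).2.
have dexp (K t : R) : is_derive t 1 (fun s => K * expR (2 * L * s))
    (K * (2 * L) * expR (2 * L * t)).
  have d1 : is_derive t 1 (fun s : R => 2 * L * s) (2 * L).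
    by have := @is_deriveZ _ _ _ id (2 * L) t 1 1 (is_derive_id _ _);
       rewrite /GRing.scale/= mulr1.
  have d2 := @is_derive1_comp _ expR (fun s : R => 2 * L * s) t _ _
    (is_derive_expR _) d1.
  have -> : K * (2 * L) * expR (2 * L * t) = K *: (expR (2 * L * t) * (2 * L)).
    by rewrite /GRing.scale/=; ring.
  exact: (@is_deriveZ _ _ _ _ K t 1 _ d2).
(* Chosen so that the first increment, at most M |t| = C (2 L |t|), is below C exp(2 L |t|). *)
pose C := M / (2 * L).
have L2 : 0 < 2 * L by rewrite mulr_gt0.
have C0 : 0 <= C by rewrite /C divr_ge0// ltW.
have bound n t : `|it n.+1 t - it n t| <= C * expR (2 * L * `|t|) / 2 ^+ n.
  elim: n t => [|n IH] t.
    rewrite expr0 divr1.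
    have := @growth_bound (fun t => it 1%N t - p) (fun=> F p)
      (fun t => M * t) (fun=> M) _ _ _ _ t.
    rewrite mulr0 subr0 => H; apply: (le_trans (H _ _ _ _)).
    - by rewrite it0 subrr.
    - move=> s; have d1 := is_deriveB (dit 0%N s) (is_derive_cst p s (1 : R)).
      by rewrite subr0 in d1; exact: d1.
    - move=> s; have := @is_deriveZ _ _ _ id M s 1 1 (is_derive_id _ _).
      by rewrite /GRing.scale/= mulr1.
    - by [].
    have -> : M * `|t| = C * (2 * L * `|t|).
      by rewrite /C; field; rewrite gt_eqF.
    rewrite ler_wpM2l//.
    by apply: le_trans (expR_ge1Dx _); rewrite lerDr ler01.
  have := @growth_bound (fun t => it n.+2 t - it n.+1 t)
    (fun t => F (it n.+1 t) - F (it n t))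
    (fun s => C / 2 ^+ n.+1 * expR (2 * L * s))
    (fun s => C / 2 ^+ n.+1 * (2 * L) * expR (2 * L * s)) _ _ _ _ t.
  move=> H; apply: (le_trans (H _ _ _ _)).
  - by rewrite !it0 subrr.
  - move=> s; apply: (le_trans (FL _ _)).
    apply: (le_trans (ler_wpM2l (ltW L0) (IH s))).
    by rewrite le_eqVlt; apply/orP; left; apply/eqP; rewrite exprS; field;
      rewrite expf_neq0// pnatr_eq0.
  rewrite mulr0 expR0 mulr1 mulrAC gerBl divr_ge0// exprn_ge0//.
have /choice[g Hg] t : exists v : V, forall n,
    `|v - it n t| <= 2 * (C * expR (2 * L * `|t|)) / 2 ^+ n.
  have /choice[l Hl] j : exists l, forall n, `|l - it n t 0 j| <=
      2 * (C * expR (2 * L * `|t|)) / 2 ^+ n.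
    apply: geometric_limit => n; apply: le_trans (bound n t).
    by have := norm_coord_le (it n.+1 t - it n t) j; rewrite !mxE.
  exists (\row_j l j) => n; apply: le_norm_row => [|j]; last by rewrite !mxE.
  by rewrite divr_ge0 ?exprn_ge0// mulr_ge0// mulr_ge0 ?expR_ge0.
have itlip n t s : `|it n t - it n s| <= M * `|t - s|.
  case: n => [|n]; first by rewrite subrr normr0 mulr_ge0.
  have := @growth_bound (fun r => it n.+1 (r + s) - it n.+1 s)
      (fun r => F (it n (r + s)) - 0) (fun t => M * t) (fun=> M) _ _ _ _ (t - s).
  rewrite mulr0 subr0 subrK; apply.
  - by rewrite add0r subrr.
  - move=> r; have := dit n (r + s) => d.
    apply: is_deriveB (is_derive_cst _ _ _).
    exact: is_derive_translate.
  - move=> r; have := @is_deriveZ _ _ _ id M r 1 1 (is_derive_id _ _).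
    by rewrite /GRing.scale/= mulr1.
  - by move=> r; rewrite subr0.
(* The common Lipschitz constant of the iterates passes to the pointwise limit, which makes [g]
   continuous and allows one more Picard step from it. *)
have glip t s : `|g t - g s| <= M * `|t - s|.
  apply: (@le_of_geometric _ _ (2 * (C * expR (2 * L * `|t|)) +
    2 * (C * expR (2 * L * `|s|)))) => n.
  have -> : g t - g s = (g t - it n t) + (it n t - it n s) + - (g s - it n s).
    by rewrite opprB !addrA !subrK.
  rewrite (le_trans (ler_normD _ _))// normrN.
  rewrite (le_trans (lerD (ler_normD _ _) (lexx _)))//.
  have := Hg t n; have := Hg s n; have := itlip n t s; lra.
have cg : continuous g.
  exact: lipschitz_continuous M0 glip.
have [h h0 dh] := prim g cg.
(* The Picard step [h] of [g] is also the limit of the iterates, so [g] is a fixed point. *)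
have hg t : h t = g t.
  apply/eqP; rewrite -subr_eq0 -normr_le0.
  apply: (@le_of_geometric _ _ (2 * (C * expR (2 * L * `|t|)))) => n.
  have hit : `|h t - it n.+1 t| <= C / 2 ^+ n * expR (2 * L * `|t|).
    have := @growth_bound (fun t => h t - it n.+1 t)
      (fun t => F (g t) - F (it n t))
      (fun s => C / 2 ^+ n * expR (2 * L * s))
      (fun s => C / 2 ^+ n * (2 * L) * expR (2 * L * s)) _ _ _ _ t.
    move=> H; apply: (le_trans (H _ _ _ _)).
    - by rewrite h0 it0 subrr.
    - move=> s; apply: (le_trans (FL _ _)).
      apply: (le_trans (ler_wpM2l (ltW L0) (Hg s n))).
      by rewrite le_eqVlt; apply/orP; left; apply/eqP; field;
        rewrite expf_neq0// pnatr_eq0.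
    by rewrite mulr0 expR0 mulr1 gerBl divr_ge0// exprn_ge0.
  have := Hg t n.+1; rewrite exprS => Hn.
  have -> : h t - g t = (h t - it n.+1 t) - (g t - it n.+1 t).
    by rewrite opprB addrA subrK.
  rewrite (le_trans (ler_normB _ _))// add0r.
  apply: (le_trans (lerD hit Hn)).
  by rewrite le_eqVlt; apply/orP; left; apply/eqP; field;
    rewrite expf_neq0// pnatr_eq0.
exists h => // t; rewrite hg; exact: dh.
Qed.

End Picard.

(** * Integral curves of a tangent field on the sphere *)

Section IntegralCurves.
Context {R : realType}.
Notation V := 'rV[R]_4.

Lemma derive_coord_sum (f : V -> V) (x v : V) : differentiable f x ->
  'D_v f x = \sum_j v 0 j *: 'D_(delta_mx 0 j) f x.
Proof.
move=> df; rewrite deriveE// {1}(row_sum_delta v) linear_sum.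
by apply: eq_bigr => j _; rewrite linearZ/= deriveE.
Qed.

Lemma bounded_on_unit_ball (f : V -> R) : continuous f ->
  exists M, forall x, `|x| <= 1 -> `|f x| <= M.
Proof.
move=> cf.
have cB := @rV_compact _ 4 (fun=> `[(-1 : R), 1]%classic)
  (fun=> @segment_compact _ _ _).
have B0 : [set v : V | forall i, `[(-1 : R), 1]%classic (v ord0 i)] !=set0.
  by exists 0 => i /=; rewrite mxE in_itv/= lerN10 ler01.
have [|c _ Hc] := EVT_max_rV B0 cB (f := fun x => `|f x|).
  apply: continuous_subspaceT => x.
  by apply: (continuous_comp (cf x)); exact: norm_continuous.
exists (`|f c|) => x x1; apply: Hc; rewrite inE => i /=.
by rewrite in_itv/= -ler_norml (le_trans (norm_coord_le x i)).
Qed.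

(** Mean value theorem on a segment, which stays in the ball by convexity; the partial derivatives
    are continuous, hence bounded there. *)
Lemma lipschitz_on_unit_ball (z : V -> V) :
  (forall x, differentiable z x) ->
  (forall v x, differentiable (fun y => 'D_v z y) x) ->
  forall j, exists K, forall u v : V, `|u| <= 1 -> `|v| <= 1 ->
    `|z u 0 j - z v 0 j| <= K * `|u - v|.
Proof.
move=> dz dDz j.
have /choice[K HK] i : exists M, forall x : V, `|x| <= 1 ->
    `|'D_(delta_mx 0 i) z x 0 j| <= M.
  apply: (@bounded_on_unit_ball (fun x => 'D_(delta_mx 0 i) z x 0 j)).
  apply: continuous_coord => x.
  exact: differentiable_continuous (dDz _ x).
exists (\sum_i K i) => u v u1 v1.
pose c (s : R) : V := v + s *: (u - v).
have dc (s : R) : is_derive s 1 c (u - v).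
  have d1 := is_derive_scalel (u - v) (is_derive_id s 1).
  have d := is_deriveD (is_derive_cst v s (1 : R)) d1.
  by move: d; rewrite add0r scale1r.
have df (s : R) : is_derive s 1 (fun s => z (c s) 0 j) (('D_(u - v) z (c s)) 0 j).
  by apply: is_derive_coord; apply: is_derive_comp_curve.
have [|s] := @MVT_segment _ (fun s => z (c s) 0 j)
    (fun s => ('D_(u - v) z (c s)) 0 j) 0 1 ler01 (fun s _ => df s).
  by apply: continuous_subspaceT => s; exact: is_derive_continuous (df s).
rewrite in_itv/= => /andP[s0 s1].
have -> : c 1 = u by rewrite /c scale1r addrC subrK.
have -> : c 0 = v by rewrite /c scale0r addr0.
rewrite subr0 mulr1 => ->.
have c1 : `|c s| <= 1.
  have -> : c s = (1 - s) *: v + s *: u.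
    by rewrite /c scalerBr scalerBl scale1r addrA addrAC.
  apply: (le_trans (ler_normD _ _)); rewrite !normrZ (ger0_norm s0).
  rewrite (ger0_norm (_ : 0 <= 1 - s)) ?subr_ge0//.
  have s1' : 0 <= 1 - s by rewrite subr_ge0.
  have := ler_wpM2l s0 u1; have := ler_wpM2l s1' v1.
  by rewrite !mulr1 => A B; apply: le_trans (lerD A B) _; rewrite subrK.
rewrite derive_coord_sum// summxE mulr_suml (le_trans (ler_norm_sum _ _ _))//.
apply: ler_sum => i _; rewrite mxE normrM mulrC ler_pM//; first exact: HK.
exact: norm_coord_le.
Qed.

(** Boundedness is included so that the class is closed under products. *)
Definition bounded_lipschitz (f : V -> R) := exists M L : R,
  forall x y, `|f x| <= M /\ `|f x - f y| <= L * `|x - y|.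

Lemma bounded_lipschitzD f g :
  bounded_lipschitz f -> bounded_lipschitz g ->
  bounded_lipschitz (fun x => f x + g x).
Proof.
move=> [M [L H]] [M' [L' H']]; exists (M + M'), (L + L') => x y.
have [f1 f2] := H x y; have [g1 g2] := H' x y; split.
  by rewrite (le_trans (ler_normD _ _))// lerD.
by rewrite opprD addrACA mulrDl (le_trans (ler_normD _ _))// lerD.
Qed.

Lemma bounded_lipschitzN f : bounded_lipschitz f -> bounded_lipschitz (fun x => - f x).
Proof.
move=> [M [L H]]; exists M, L => x y; have [f1 f2] := H x y.
by rewrite normrN -opprD normrN.
Qed.

Lemma bounded_lipschitzM f g :
  bounded_lipschitz f -> bounded_lipschitz g ->
  bounded_lipschitz (fun x => f x * g x).
Proof.
move=> [M [L H]] [M' [L' H']]; exists (M * M'), (M * L' + M' * L) => x y.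
have [f1 f2] := H x y; have [g1 g2] := H' x y.
have [_ f2'] := H y x; have [g1' _] := H' y x; split; first by rewrite normrM ler_pM.
have -> : f x * g x - f y * g y = f x * (g x - g y) + g y * (f x - f y) by ring.
rewrite (le_trans (ler_normD _ _))// !normrM mulrDl -!mulrA lerD//.
  by rewrite ler_pM.
by rewrite ler_pM.
Qed.

Lemma bounded_lipschitz_dot (f g : V -> V) :
  (forall j, bounded_lipschitz (fun x => f x 0 j)) ->
  (forall j, bounded_lipschitz (fun x => g x 0 j)) ->
  bounded_lipschitz (fun x => dot (f x) (g x)).
Proof.
move=> Hf Hg; rewrite (_ : (fun x => dot (f x) (g x)) = fun x =>
    f x 0 0 * g x 0 0 + f x 0 1 * g x 0 1 + f x 0 2 * g x 0 2
    + f x 0 3 * g x 0 3); last by apply/funext => x; rewrite dotE.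
by do ?apply: bounded_lipschitzD; apply: bounded_lipschitzM.
Qed.

(** Radial retraction onto the unit ball of the sup norm. It fixes S^3, whose points have sup norm
    at most 1. *)
Definition retract (x : V) : V := (Num.max 1 `|x|)^-1 *: x.

Lemma retract_norm x : `|retract x| <= 1.
Proof.
rewrite /retract normrZ ger0_norm ?invr_ge0 ?le_max ?ler01//.
by rewrite mulrC ler_pdivrMr ?lt_max ?ltr01// mul1r le_max lexx orbT.
Qed.

Lemma retract_lipschitz x y : `|retract x - retract y| <= 2 * `|x - y|.
Proof.
set mx := Num.max 1 `|x|; set my := Num.max 1 `|y|.
have mx1 : 1 <= mx by rewrite le_max lexx.
have my1 : 1 <= my by rewrite le_max lexx.
have mx0 : 0 < mx by exact: lt_le_trans mx1.
have my0 : 0 < my by exact: lt_le_trans my1.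
have mxV : 0 <= mx^-1 by rewrite invr_ge0 ltW.
have myV : 0 <= my^-1 by rewrite invr_ge0 ltW.
have ymy : `|y| <= my by rewrite le_max lexx orbT.
(* The constant 2 counts the change of the vector and the change of the scaling factor
   separately. *)
have E : retract x - retract y =
    mx^-1 *: (x - y) + (mx^-1 * (my - mx)) *: (my^-1 *: y).
  rewrite scalerA scalerBr /retract -/mx -/my -addrA; congr (_ + _).
  rewrite -scaleNr -scaleNr -scalerDl; congr (_ *: _); field.
  by rewrite !gt_eqF.
rewrite E (le_trans (ler_normD _ _))// mulrDl mul1r lerD//.
  by rewrite normrZ (ger0_norm mxV) ler_piMl// invf_le1.
have H1 : `|my^-1 *: y| <= 1.
  by rewrite normrZ (ger0_norm myV) mulrC ler_pdivrMr// mul1r.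
have H2 : `|my - mx| <= `|x - y|.
  have := ler_dist_dist x y; rewrite ler_norml => /andP[D1 D2].
  by rewrite /mx /my ler_norml /Num.max; do 2 case: ltP => ?; lra.
rewrite normrZ normrM (ger0_norm mxV).
rewrite (le_trans (ler_piMr _ H1)) ?mulr_ge0//.
by rewrite (le_trans _ H2)// ler_piMl// invf_le1.
Qed.

Lemma S3_norm (p : V) : S3 p -> `|p| <= 1.
Proof.
rewrite /S3 dotE => Sp; apply: le_norm_row => // j.
rewrite -ler_sqr ?nnegrE// expr1n real_normK ?num_real//.
move: j; apply: forall_I4; rewrite -Sp ?expr2.
- have := sqr_ge0 (p 0 1); have := sqr_ge0 (p 0 2); have := sqr_ge0 (p 0 3); lra.
- have := sqr_ge0 (p 0 0); have := sqr_ge0 (p 0 2); have := sqr_ge0 (p 0 3); lra.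
- have := sqr_ge0 (p 0 1); have := sqr_ge0 (p 0 0); have := sqr_ge0 (p 0 3); lra.
- have := sqr_ge0 (p 0 1); have := sqr_ge0 (p 0 2); have := sqr_ge0 (p 0 0); lra.
Qed.

Lemma compact_S3 : compact (@S3 R : set V).
Proof.
apply: bounded_closed_compact.
  by exists 1; split; [exact: num_real|move=> M M1 p /S3_norm/le_trans; apply; exact: ltW].
rewrite (_ : S3 (R:=R) = (fun p : V => dot p p) @^-1` [set 1]) //.
apply: closed_comp; last exact: closed_eq.
by move=> p _; apply: continuous_dot => q; exact: cvg_id.
Qed.

Lemma S3_nonempty : @S3 R !=set0.
Proof. by exists (delta_mx 0 0); rewrite /S3 /= dotE !mxE /=; ring. Qed.

Lemma S3_min (f : V -> R) : continuous f ->
  exists2 p, S3 p & forall q, S3 q -> f p <= f q.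
Proof.
move=> cf.
have [|p] := EVT_min_rV (f := f) S3_nonempty compact_S3.
  exact: continuous_subspaceT.
by rewrite inE => Sp H; exists p => // q Sq; apply: H; rewrite inE.
Qed.

(* The field |y|^2 z(y) - <z(y), y> y at y = retract x is bounded, globally
   Lipschitz, equal to z on S^3, and orthogonal to x since y is parallel to x;
   so its solutions starting on S^3 never leave it. *)
Lemma exists_integral_curve (z : V -> V) (p : V) :
  smooth_field z -> unit_vector_field z -> S3 p ->
  exists2 g, integral_curve z g & g 0 = p.
Proof.
move=> sz uz Sp.
have dz x : differentiable z x by exact: (sz [::] x).
have dDz v x : differentiable (fun y => 'D_v z y) x by exact: (sz [:: v] x).
pose F x := dot (retract x) (retract x) *: z (retract x)
            - dot (z (retract x)) (retract x) *: retract x.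
have br j : bounded_lipschitz (fun x => retract x 0 j).
  exists 1, 2 => x y; split.
    by apply: le_trans (retract_norm x); exact: norm_coord_le.
  by have := norm_coord_le (retract x - retract y) j; rewrite !mxE => /le_trans;
    apply; exact: retract_lipschitz.
have bz j : bounded_lipschitz (fun x => z (retract x) 0 j).
  have [M HM] : exists M, forall x : V, `|x| <= 1 -> `|z x 0 j| <= M.
    apply: (@bounded_on_unit_ball (fun x => z x 0 j)).
    by apply: continuous_coord => x; exact: differentiable_continuous (dz x).
  have [K HK] := lipschitz_on_unit_ball dz dDz j.
  exists M, (2 * `|K|) => x y; split; first exact: HM (retract_norm x).
  apply: (le_trans (HK _ _ (retract_norm x) (retract_norm y))).
  rewrite (le_trans (ler_wpM2r _ (ler_norm K)))//.
  by rewrite (mulrC 2) -mulrA ler_wpM2l// retract_lipschitz.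
have bF j : bounded_lipschitz (fun x => F x 0 j).
  rewrite (_ : (fun x => F x 0 j) = fun x =>
    dot (retract x) (retract x) * z (retract x) 0 j
    + - (dot (z (retract x)) (retract x) * retract x 0 j)); last first.
    by apply/funext => x; rewrite !mxE.
  by apply: bounded_lipschitzD; [|apply: bounded_lipschitzN]; apply: bounded_lipschitzM => //;
    exact: bounded_lipschitz_dot.
have /choice[M /choice[L HF]] := bF.
pose M' := \sum_j `|M j|; pose L' := 1 + \sum_j `|L j|.
have leS (h : 'I_4 -> R) j : h j <= \sum_j `|h j|.
  by rewrite (bigD1 j)//= (le_trans (ler_norm _))// lerDl sumr_ge0.
have M'0 : 0 <= M' by exact: sumr_ge0.
have L'0 : 0 < L' by rewrite ltr_pwDl// sumr_ge0.
have FM x : `|F x| <= M'.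
  by apply: le_norm_row => // j; apply: le_trans (HF j x x).1 (leS M j).
have FL x y : `|F x - F y| <= L' * `|x - y|.
  apply: le_norm_row => [|j]; first by rewrite mulr_ge0// ltW.
  have -> : (F x - F y) 0 j = F x 0 j - F y 0 j by rewrite !mxE.
  by apply: le_trans (HF j x y).2 _; rewrite ler_wpM2r// ler_wpDl// leS.
have [g g0 dg] := picard p L'0 FM FL.
have tan x : dot (F x) x = 0.
  rewrite /F /retract; set k := (Num.max _ _)^-1; rewrite !dotE !mxE; ring.
have Sg t : dot (g t) (g t) = 1.
  rewrite -Sp -g0; apply: (@is_derive_0_is_cst _ (fun t => dot (g t) (g t))) => s.
  have d := is_derive_dot (dg s) (dg s).
  by rewrite (dotC (g s)) tan addr0 in d.
exists g => // t; split; first exact: Sg.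
have rt : retract (g t) = g t.
  by rewrite /retract max_l ?invr1 ?scale1r//; exact: S3_norm.
have := dg t; rewrite /F rt Sg (uz _ (Sg t)).1 scale1r scale0r subr0.
exact.
Qed.

End IntegralCurves.

(** * Leaves as great circles *)

Section Flow.
Context {R : realType}.
Notation V := 'rV[R]_4.

Lemma dotDl (x y u : V) : dot (x + y) u = dot x u + dot y u.
Proof. by rewrite /dot mulmxDl mxE. Qed.

Lemma dotZl (a : R) (x u : V) : dot (a *: x) u = a * dot x u.
Proof. by rewrite /dot -scalemxAl mxE. Qed.

Lemma dotDr (x y u : V) : dot u (x + y) = dot u x + dot u y.
Proof. by rewrite dotC dotDl !(dotC u). Qed.

Lemma dotZr (a : R) (x u : V) : dot u (a *: x) = a * dot u x.
Proof. by rewrite dotC dotZl dotC. Qed.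

Lemma dotNl (x u : V) : dot (- x) u = - dot x u.
Proof. by rewrite -scaleN1r dotZl mulN1r. Qed.

Lemma dotNr (x u : V) : dot u (- x) = - dot u x.
Proof. by rewrite dotC dotNl dotC. Qed.

Lemma dot0l (u : V) : dot 0 u = 0.
Proof. by rewrite -(scale0r u) dotZl mul0r. Qed.

Definition dotL := (dotDl, dotDr, dotZl, dotZr, dotNl, dotNr).

Lemma dot_ge0 (x : V) : 0 <= dot x x.
Proof. by rewrite dotE -!expr2 !addr_ge0 ?sqr_ge0. Qed.

Lemma dot_eq0 (x : V) : dot x x = 0 -> x = 0.
Proof.
rewrite dotE -!expr2 => /eqP.
rewrite paddr_eq0 ?addr_ge0 ?sqr_ge0// => /andP[+ /eqP e3].
rewrite paddr_eq0 ?addr_ge0 ?sqr_ge0// => /andP[+ /eqP e2].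
rewrite paddr_eq0 ?addr_ge0 ?sqr_ge0// => /andP[/eqP e0 /eqP e1].
by apply: row4P; rewrite mxE; apply/eqP; rewrite -sqrf_eq0; apply/eqP.
Qed.

Definition circ (p v : V) (t : R) : V := cos t *: p + sin t *: v.

Lemma circ0 p v : circ p v 0 = p.
Proof. by rewrite /circ cos0 sin0 scale1r scale0r addr0. Qed.

Lemma is_derive_circ p v (t : R) : is_derive t 1 (circ p v) (circ v (- p) t).
Proof.
have d := is_deriveD (is_derive_scalel p (is_derive_cos t))
                     (is_derive_scalel v (is_derive_sin t)).
by move: d; rewrite scaleNr -scalerN (addrC (sin t *: - p)); exact.
Qed.

Lemma cos_sin_sqr t : cos t * cos t + sin t * sin t = 1 :> R.
Proof. by have := cos2Dsin2 t; rewrite !expr2. Qed.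

Lemma dot_circ p v t : dot p p = 1 -> dot v v = 1 -> dot p v = 0 ->
  dot (circ p v t) (circ p v t) = 1.
Proof.
move=> p1 v1 pv; rewrite /circ !dotL (dotC v p) p1 v1 pv.
by rewrite -[RHS](cos_sin_sqr t); ring.
Qed.

Lemma cos_sin_surjective (a b : R) : a * a + b * b = 1 ->
  exists t, cos t = a /\ sin t = b.
Proof.
move=> ab.
have a1 : -1 <= a <= 1.
  rewrite -ler_norml -ler_sqr ?nnegrE// expr1n real_normK ?num_real// expr2.
  by have := sqr_ge0 b; rewrite expr2; lra.
have sE : sin (acos a) = `|b|.
  by rewrite sin_acos// -sqrtr_sqr; congr Num.sqrt; rewrite !expr2; lra.
have [b0|b0] := leP 0 b.
  by exists (acos a); rewrite acosK ?in_itv// sE ger0_norm.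
by exists (- acos a); rewrite cosN sinN acosK ?in_itv// sE ltr0_norm// opprK.
Qed.

(** The hypothesis is applied to the difference of [m] and its projection, which is orthogonal to
    [u] and [v]: the difference is then orthogonal to itself. *)
Lemma in_plane (u v m : V) : dot u u = 1 -> dot v v = 1 -> dot u v = 0 ->
  (forall n, dot n u = 0 -> dot n v = 0 -> dot n m = 0) ->
  m = dot m u *: u + dot m v *: v.
Proof.
move=> u1 v1 uv H; apply/eqP; rewrite -subr_eq0; apply/eqP/dot_eq0.
have [n nE] : exists n, n = m - (dot m u *: u + dot m v *: v) by eexists.
have nu : dot n u = 0 by rewrite nE !dotL u1 (dotC v) uv; ring.
have nv : dot n v = 0 by rewrite nE !dotL v1 uv; ring.
by rewrite -{1}nE !dotL nu nv H//; ring.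
Qed.

(** The hypothesis gives only the range of the integral curve g as a set. Its plane contains g, the
    velocity z(g) and the acceleration w; differentiating |z(g)| = 1 and <z(g), g> = 0 determines w
    = - g, and this equation fixes the parametrisation. *)
Lemma great_circle_flow (z : V -> V) : smooth_field z -> unit_vector_field z ->
  integral_curves_great_circles z ->
  forall p t, S3 p -> z (circ p (z p) t) = circ (z p) (- p) t.
Proof.
move=> sz uz gz p t Sp.
have dz x : differentiable z x by exact: (sz [::] x).
have [g cg g0] := exists_integral_curve sz uz Sp.
have [u [v [u1 v1 uv rg]]] := gz g cg.
have Sg s : dot (g s) (g s) = 1 by exact: (cg s).1.
have dg s : is_derive s (1 : R) g (z (g s)) by exact: (cg s).2.
pose w s := 'D_(z (g s)) z (g s).
have dzg s : is_derive s (1 : R) (fun s => z (g s)) (w s).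
  exact: is_derive_comp_curve.
have z1 s : dot (z (g s)) (z (g s)) = 1 by exact: (uz _ (Sg s)).2.
have z0 s : dot (z (g s)) (g s) = 0 by exact: (uz _ (Sg s)).1.
have dcst (f : R -> R) (k : R) s a :
    (forall s, f s = k) -> is_derive s (1 : R) f a -> a = 0.
  move=> fk; have -> : f = cst k by apply/funext.
  by move=> d; exact: is_derive_unique d (is_derive_cst _ _ _).
have pg n : dot n u = 0 -> dot n v = 0 -> forall s, dot n (g s) = 0.
  move=> nu nv s; have : range g (g s) by exists s.
  by rewrite rg => -[r _ <-]; rewrite !dotL nu nv; ring.
have ddot n (c c' : R -> V) s : is_derive s (1 : R) c (c' s) ->
    is_derive s (1 : R) (fun s => dot n (c s)) (dot n (c' s)).
  by move=> d; have := is_derive_dot (is_derive_cst n s 1) d; rewrite dot0l add0r.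
have pz n : dot n u = 0 -> dot n v = 0 -> forall s, dot n (z (g s)) = 0.
  by move=> nu nv s;
    exact: (dcst _ 0 s _ (pg n nu nv) (ddot n g (fun s => z (g s)) s (dg s))).
have pw n : dot n u = 0 -> dot n v = 0 -> forall s, dot n (w s) = 0.
  by move=> nu nv s;
    exact: (dcst _ 0 s _ (pz n nu nv) (ddot n (fun s => z (g s)) w s (dzg s))).
have w1 s : dot (w s) (z (g s)) = 0.
  have := dcst _ 1 s _ z1 (is_derive_dot (dzg s) (dzg s)).
  by rewrite (dotC (z (g s))); lra.
have w2 s : dot (w s) (g s) = -1.
  have := dcst _ 0 s _ z0 (is_derive_dot (dzg s) (dg s)).
  by rewrite z1; lra.
(* The vector w + g lies in the plane of the circle and is orthogonal to g and z(g), an orthonormal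
   basis of that plane. *)
have wE s : w s = - g s.
  apply/eqP; rewrite -addr_eq0; apply/eqP; set m := w s + g s.
  have mE : m = dot m u *: u + dot m v *: v.
    apply: in_plane => // n nu nv; by rewrite /m dotDr pg// pw// addr0.
  have gE := in_plane u1 v1 uv (fun n nu nv => pg n nu nv s).
  have zE := in_plane u1 v1 uv (fun n nu nv => pz n nu nv s).
  have mg : dot m (g s) = 0 by rewrite /m !dotL w2 Sg; ring.
  have mz : dot m (z (g s)) = 0 by rewrite /m !dotL w1 (dotC (g s)) z0; ring.
  have [a [b gx]] : exists a b, forall y, dot (g s) y = a * dot u y + b * dot v y.
    by exists (dot (g s) u), (dot (g s) v) => y; rewrite {1}gE !dotL.
  have [c [d zx]] : exists c d, forall y, dot (z (g s)) y = c * dot u y + d * dot v y.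
    by exists (dot (z (g s)) u), (dot (z (g s)) v) => y; rewrite {1}zE !dotL.
  have [m1 [m2 mE']] : exists m1 m2, m = m1 *: u + m2 *: v by exists (dot m u), (dot m v).
  have vu : dot v u = 0 by rewrite dotC.
  have E1 : a * a + b * b = 1.
    by rewrite -(Sg s) gx (dotC u) (dotC v) !gx u1 v1 uv vu; ring.
  have E2 : c * c + d * d = 1.
    by rewrite -(z1 s) zx (dotC u) (dotC v) !zx u1 v1 uv vu; ring.
  have E3 : a * c + b * d = 0.
    by rewrite -(z0 s) zx (dotC u) (dotC v) !gx u1 v1 uv vu; ring.
  have E4 : m1 * a + m2 * b = 0.
    by rewrite -mg mE' !dotL (dotC u) (dotC v) !gx u1 v1 uv vu; ring.
  have E5 : m1 * c + m2 * d = 0.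
    by rewrite -mz mE' !dotL (dotC u) (dotC v) !zx u1 v1 uv vu; ring.
  (* The squared determinant is the Gram determinant, so the system for [m1], [m2] is invertible. *)
  have D1 : (a * d - b * c) * (a * d - b * c) = 1.
    have -> : (a * d - b * c) * (a * d - b * c) =
      (a * a + b * b) * (c * c + d * d) - (a * c + b * d) * (a * c + b * d) by ring.
    by rewrite E1 E2 E3; ring.
  have M1 : m1 = 0.
    rewrite -[m1]mulr1 -D1.
    have -> : m1 * ((a * d - b * c) * (a * d - b * c)) =
      (a * d - b * c) * (d * (m1 * a + m2 * b) - b * (m1 * c + m2 * d)) by ring.
    by rewrite E4 E5; ring.
  have M2 : m2 = 0.
    rewrite -[m2]mulr1 -D1.
    have -> : m2 * ((a * d - b * c) * (a * d - b * c)) =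
      (a * d - b * c) * (a * (m1 * c + m2 * d) - c * (m1 * a + m2 * b)) by ring.
    by rewrite E4 E5; ring.
  by rewrite mE' M1 M2 !scale0r addr0.
(* Rotating the pair (g, z(g)) back by the angle s gives constants, since g' = z(g) and z(g)' = -
   g. *)
have A s : cos s *: g s - sin s *: z (g s) = p.
  pose c s := cos s *: g s - sin s *: z (g s).
  have <- : c 0 = p by rewrite /c cos0 sin0 g0 ?scale0r ?scale1r ?subr0 ?add0r.
  apply: (is_derive_cst_V (c := c)) => r.
  have d := is_deriveB (is_derive_scale (is_derive_cos r) (dg r))
                       (is_derive_scale (is_derive_sin r) (dzg r)).
  move: d; rewrite wE => d; apply: is_derive_eq d _.
  by apply/rowP => j; rewrite !mxE; ring.
have B s : sin s *: g s + cos s *: z (g s) = z p.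
  pose c s := sin s *: g s + cos s *: z (g s).
  have <- : c 0 = z p by rewrite /c cos0 sin0 g0 ?scale0r ?scale1r ?subr0 ?add0r.
  apply: (is_derive_cst_V (c := c)) => r.
  have d := is_deriveD (is_derive_scale (is_derive_sin r) (dg r))
                       (is_derive_scale (is_derive_cos r) (dzg r)).
  move: d; rewrite wE => d; apply: is_derive_eq d _.
  by apply/rowP => j; rewrite !mxE; ring.
have E1 : circ p (z p) t = g t.
  rewrite /circ -(B t) -{1}(A t) -[RHS]scale1r -(cos_sin_sqr t).
  by apply/rowP => j; rewrite !mxE; ring.
rewrite E1 /circ -(B t) -{1}(A t) -[LHS]scale1r -(cos_sin_sqr t).
by apply/rowP => j; rewrite !mxE; ring.
Qed.

End Flow.

(** * Self-dual and anti-self-dual parts of simple bivectors *)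

Section SelfDualParts.
Context {R : realType}.
Notation V := 'rV[R]_4.
Implicit Types (e : R) (x y u v p q : V).

(* Components of the self-dual (e = 1) or anti-self-dual (e = -1) part of the
   bivector x /\ y. *)
Definition wedge (e : R) (k : 'I_3) (x y : V) : R :=
  match val k with
  | 0 => x 0 0 * y 0 1 - x 0 1 * y 0 0 + e * (x 0 2 * y 0 3 - x 0 3 * y 0 2)
  | 1 => x 0 0 * y 0 2 - x 0 2 * y 0 0 + e * (x 0 3 * y 0 1 - x 0 1 * y 0 3)
  | _ => x 0 0 * y 0 3 - x 0 3 * y 0 0 + e * (x 0 1 * y 0 2 - x 0 2 * y 0 1)
  end.

Lemma is_derive_wedge e k (c g : R -> V) (t : R) (v w : V) :
  is_derive t 1 c v -> is_derive t 1 g w ->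
  is_derive t 1 (fun s => wedge e k (c s) (g s))
    (wedge e k v (g t) + wedge e k (c t) w).
Proof.
move=> dc dg.
have dC j := is_derive_coord j dc; have dG j := is_derive_coord j dg.
move: k; apply: forall_I3; rewrite /wedge /=.
- by apply: is_derive_eq; rewrite /GRing.scale/=; ring.
- by apply: is_derive_eq; rewrite /GRing.scale/=; ring.
- by apply: is_derive_eq; rewrite /GRing.scale/=; ring.
Qed.

Lemma continuous_wedge e k (f g : V -> V) : continuous f -> continuous g ->
  continuous (fun x => wedge e k (f x) (g x)).
Proof.
move=> cf cg.
have P i j : continuous (fun x => f x 0 i * g x 0 j).
  by apply: continuous_mul; exact: continuous_coord.
have D i j : continuous (fun x => f x 0 i * g x 0 j - f x 0 j * g x 0 i).
  exact: continuous_add (P i j) (continuous_opp (P j i)).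
have main i j i' j' : continuous (fun x => f x 0 i * g x 0 j
    - f x 0 j * g x 0 i + e * (f x 0 i' * g x 0 j' - f x 0 j' * g x 0 i')).
  apply: continuous_add (D i j) (continuous_mul _ (D i' j')).
  exact: cst_continuous.
by move: k; apply: forall_I3; rewrite /wedge /=; exact: main.
Qed.

(** Laplace expansion, along the first two rows, of the determinant with rows x, y, u, v. *)
Definition det4 (x y u v : V) : R :=
  (x 0 0 * y 0 1 - x 0 1 * y 0 0) * (u 0 2 * v 0 3 - u 0 3 * v 0 2)
  - (x 0 0 * y 0 2 - x 0 2 * y 0 0) * (u 0 1 * v 0 3 - u 0 3 * v 0 1)
  + (x 0 0 * y 0 3 - x 0 3 * y 0 0) * (u 0 1 * v 0 2 - u 0 2 * v 0 1)
  + (x 0 1 * y 0 2 - x 0 2 * y 0 1) * (u 0 0 * v 0 3 - u 0 3 * v 0 0)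
  - (x 0 1 * y 0 3 - x 0 3 * y 0 1) * (u 0 0 * v 0 2 - u 0 2 * v 0 0)
  + (x 0 2 * y 0 3 - x 0 3 * y 0 2) * (u 0 0 * v 0 1 - u 0 1 * v 0 0).

(** Since e^2 = 1, the product of the parts is the Gram pairing of the bivectors plus e times their
    exterior product. The difference of the two signs therefore isolates the determinant. *)
Lemma wedge_dot e x y u v : e = 1 \/ e = -1 ->
  \sum_k wedge e k x y * wedge e k u v =
  dot x u * dot y v - dot x v * dot y u + e * det4 x y u v.
Proof. by case=> ->; rewrite sum_I3 !dotE /wedge /det4 /=; ring. Qed.

(** A rotation inside a plane preserves its bivector; this is why the Gauss maps are constant along
    leaves. *)
Lemma wedge_circ e k p v t :
  wedge e k (circ p v t) (circ v (- p) t) = wedge e k p v.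
Proof.
rewrite -[RHS]mul1r -(cos_sin_sqr t) /circ.
by move: k; apply: forall_I3; rewrite /wedge /= !mxE; ring.
Qed.

(** Triple vector product of R^4, dual to the determinant in its last argument. *)
Definition cross4 (x y u : V) : V := vec4
  (- (x 0 1 * y 0 2 - x 0 2 * y 0 1) * u 0 3
   + (x 0 1 * y 0 3 - x 0 3 * y 0 1) * u 0 2
   - (x 0 2 * y 0 3 - x 0 3 * y 0 2) * u 0 1)
  ((x 0 0 * y 0 2 - x 0 2 * y 0 0) * u 0 3
   - (x 0 0 * y 0 3 - x 0 3 * y 0 0) * u 0 2
   + (x 0 2 * y 0 3 - x 0 3 * y 0 2) * u 0 0)
  (- (x 0 0 * y 0 1 - x 0 1 * y 0 0) * u 0 3
   + (x 0 0 * y 0 3 - x 0 3 * y 0 0) * u 0 1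
   - (x 0 1 * y 0 3 - x 0 3 * y 0 1) * u 0 0)
  ((x 0 0 * y 0 1 - x 0 1 * y 0 0) * u 0 2
   - (x 0 0 * y 0 2 - x 0 2 * y 0 0) * u 0 1
   + (x 0 1 * y 0 2 - x 0 2 * y 0 1) * u 0 0).

Lemma dot_cross4 x y u v : dot (cross4 x y u) v = det4 x y u v.
Proof. by rewrite dotE /cross4 /vec4 !mxE /= /det4; ring. Qed.

Lemma det4_swap x y u v : det4 x y v u = - det4 x y u v.
Proof. by rewrite /det4; ring. Qed.

Lemma det4_flip x y u v : det4 u v x y = det4 x y u v.
Proof. by rewrite /det4; ring. Qed.

Lemma det4_repeat x y u : [/\ det4 x y u x = 0, det4 x y u y = 0 & det4 x y u u = 0].
Proof. by split; rewrite /det4; ring. Qed.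

Lemma cramer4 x y u w v : det4 x y u w *: v =
  dot w v *: cross4 x y u - dot u v *: cross4 x y w
  + dot y v *: cross4 x u w - dot x v *: cross4 y u w.
Proof.
by apply: row4P; rewrite !dotE /cross4 /vec4 !mxE /= /det4; ring.
Qed.

(** The right-hand side is the Gram determinant of x, y, u. *)
Lemma norm_cross4 x y u : dot (cross4 x y u) (cross4 x y u) =
  dot x x * dot y y * dot u u + 2 * (dot x y * dot y u * dot x u)
  - dot x x * (dot y u * dot y u) - dot y y * (dot x u * dot x u)
  - dot u u * (dot x y * dot x y).
Proof. by rewrite !dotE /cross4 /vec4 !mxE /=; ring. Qed.

Definition orthonormal_pair p v := [/\ dot p p = 1, dot v v = 1 & dot p v = 0].

(** On the plane orthogonal to p and v, [cross4 p v] is a rotation by a right angle. *)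
Lemma rotate_norm p v n : orthonormal_pair p v -> dot p n = 0 -> dot v n = 0 ->
  dot (cross4 p v n) (cross4 p v n) = dot n n.
Proof.
by case=> p1 v1 pv pn vn; rewrite norm_cross4 p1 v1 pv pn vn; ring.
Qed.

(** The vectors p, v, n and [cross4 p v n] have determinant |n|^2, hence form a basis; by Cramer's
    rule a vector orthogonal to all four is 0. *)
Lemma in_span p v n y : orthonormal_pair p v -> n <> 0 -> dot p n = 0 -> dot v n = 0 ->
  dot n y = 0 -> dot (cross4 p v n) y = 0 -> y = dot y p *: p + dot y v *: v.
Proof.
move=> pv_on n0 pn vn ny my; have [p1 v1 pv] := pv_on.
pose m := cross4 p v n; pose y' := y - (dot y p *: p + dot y v *: v).
have mp : dot m p = 0 by rewrite dot_cross4; have [] := det4_repeat p v n.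
have mv : dot m v = 0 by rewrite dot_cross4; have [] := det4_repeat p v n.
have D : det4 p v n m <> 0.
  by rewrite -dot_cross4 (rotate_norm pv_on pn vn) => /dot_eq0.
apply/eqP; rewrite -subr_eq0 -/y'.
have := cramer4 p v n m y'.
have -> : dot m y' = 0 by rewrite /y' !dotL my mp mv; ring.
have -> : dot n y' = 0 by rewrite /y' !dotL ny (dotC n) pn (dotC n) vn; ring.
have -> : dot v y' = 0 by rewrite /y' !dotL v1 (dotC v p) pv (dotC v y); ring.
have -> : dot p y' = 0 by rewrite /y' !dotL p1 pv (dotC p y); ring.
rewrite !scale0r !subr0 addr0 => /eqP; rewrite scaler_eq0 => /orP[/eqP//|//].
Qed.

(** Two planes of R^4 with vanishing determinant share a line. The lemma provides a unit vector of
    it in both bases. *)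
Lemma common_vector p v q r : orthonormal_pair p v -> orthonormal_pair q r ->
  det4 p v q r = 0 ->
  exists a b c d, [/\ a * a + b * b = 1, c * c + d * d = 1 &
    a *: p + b *: v = c *: q + d *: r].
Proof.
move=> pv_on qr_on D0; have [p1 v1 pv] := pv_on; have [q1 r1 qr] := qr_on.
have [c [d [cd0 yE]]] : exists c d, c * c + d * d <> 0 /\
    c *: q + d *: r = dot (c *: q + d *: r) p *: p + dot (c *: q + d *: r) v *: v.
  pose n := cross4 p v q.
  (* If n = 0 then q itself lies in the first plane: the Gram determinant of p, v, q is the squared
     distance from q to it. *)
  have [n0|n0] := pselect (n = 0).
    exists 1, 0; split; first by rewrite mulr0 addr0 mulr1; exact/eqP/oner_neq0.
    rewrite scale1r scale0r addr0; apply/eqP; rewrite -subr_eq0; apply/eqP/dot_eq0.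
    have := norm_cross4 p v q; rewrite -/n n0 dot0l p1 v1 q1 pv => E.
    rewrite !dotL p1 v1 q1 pv (dotC v p) pv (dotC q p) (dotC q v).
    by rewrite [RHS]E; ring.
  have [np nv nq] := det4_repeat p v q; rewrite -!dot_cross4 -/n in np nv nq.
  pose m := cross4 p v n.
  have mq : dot m q <> 0.
    by rewrite dot_cross4 det4_swap -dot_cross4 -/n => /eqP;
      rewrite oppr_eq0 => /eqP/dot_eq0.
  (* This combination of q and r is orthogonal to m by construction, and to n because both q and r
     are, the latter by the vanishing determinant. *)
  exists (dot m r), (- dot m q); split.
    move=> /eqP; rewrite mulrNN paddr_eq0 -?expr2 ?sqr_ge0// => /andP[_].
    by rewrite sqrf_eq0 => /eqP.
  apply: (in_span pv_on n0); rewrite 1?(dotC _ n)//.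
    by rewrite !dotL nq (dot_cross4 p v q r) D0; ring.
  by rewrite -/m !dotL; ring.
set y := c *: q + d *: r in yE.
pose a := dot y p; pose b := dot y v.
have yy : dot y y = c * c + d * d by rewrite /y !dotL q1 r1 qr (dotC r) qr; ring.
have yy' : dot y y = a * a + b * b.
  by rewrite {1}yE dotDl !dotZl (dotC p y) (dotC v y).
pose s := Num.sqrt (dot y y).
have ss : s * s = dot y y by rewrite -expr2 sqr_sqrtr// dot_ge0.
have s0 : s != 0.
  by apply/eqP => s0; apply: cd0; rewrite -yy -ss s0 mulr0.
exists (a / s), (b / s), (c / s), (d / s); split.
- rewrite (_ : _ + _ = (a * a + b * b) / (s * s)); last by field.
  by rewrite -yy' ss divff// -ss mulf_neq0.
- rewrite (_ : _ + _ = (c * c + d * d) / (s * s)); last by field.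
  by rewrite -yy ss divff// -ss mulf_neq0.
- rewrite !(mulrC _ s^-1) -!scalerA -!scalerDr; congr (_ *: _).
  by rewrite -/y [RHS]yE.
Qed.

End SelfDualParts.

(** * Pairing of leaves *)

Section Leaves.
Context {R : realType}.
Notation V := 'rV[R]_4.
Variable z : V -> V.
Hypothesis (uz : unit_vector_field z).
Hypothesis (zcirc : forall p t, S3 p -> z (circ p (z p) t) = circ (z p) (- p) t).
Hypothesis (dz : forall x, differentiable z x).
Implicit Types p q x y : V.

Let on p : S3 p -> orthonormal_pair p (z p).
Proof. by move=> Sp; have [zp zz] := uz Sp; split => //; rewrite dotC. Qed.

Definition pairing p q := det4 p (z p) q (z q).

Lemma pairingC p q : pairing p q = pairing q p.
Proof. exact: det4_flip. Qed.

(** A common unit vector of the two leaf planes lies on both leaves, and [zcirc] computes z there in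
    two ways. *)
Lemma same_leaf p q : S3 p -> S3 q -> pairing p q = 0 ->
  exists t s, circ p (z p) t = circ q (z q) s /\
              circ (z p) (- p) t = circ (z q) (- q) s.
Proof.
move=> Sp Sq /(common_vector (on Sp) (on Sq))[a [b [c [d [ab cd E]]]]].
have [t [ta tb]] := cos_sin_surjective ab.
have [s [sc sd]] := cos_sin_surjective cd.
have E' : circ p (z p) t = circ q (z q) s by rewrite /circ ta tb sc sd.
by exists t, s; split=> //; rewrite -!zcirc// E'.
Qed.

Lemma same_leaf_wedge p q : S3 p -> S3 q -> pairing p q = 0 ->
  forall e k, wedge e k p (z p) = wedge e k q (z q).
Proof.
move=> Sp Sq /(same_leaf Sp Sq)[t [s [E1 E2]]] e k.
by rewrite -(wedge_circ e k p (z p) t) E1 E2 wedge_circ.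
Qed.

(** Certificate that q is off the leaf of p: a vector normal to the plane of that leaf which detects
    q. *)
Lemma pairing_neq0 p q n : S3 p -> S3 q -> dot n p = 0 -> dot n (z p) = 0 ->
  dot n q <> 0 -> pairing p q <> 0.
Proof.
move=> Sp Sq np nz nq /(same_leaf Sp Sq)[t [s [E1 E2]]]; apply: nq.
have -> : q = cos s *: circ q (z q) s - sin s *: circ (z q) (- q) s.
  rewrite -[LHS]scale1r -(cos_sin_sqr s) /circ.
  by apply/rowP => j; rewrite !mxE; ring.
by rewrite -E1 -E2 /circ !dotL np nz; ring.
Qed.

Lemma nonvanishing_sign (f : R -> R) a b : continuous f ->
  (forall t, f t <> 0) -> 0 < f a * f b.
Proof.
move=> cf f0; wlog ab : a b / a <= b.
  move=> H; case: (leP a b) => [|/ltW] ab; first exact: H.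
  by rewrite mulrC; exact: H.
rewrite ltNge; apply/negP => fab.
have [||c _ /f0//] := @IVT R f a b 0 ab.
  exact: continuous_subspaceT.
rewrite ge_min le_max; have [fa|fa] := ltP 0 (f a).
  have fb : f b <= 0 by rewrite -(pmulr_rle0 _ fa).
  by rewrite ?fb ?(ltW fa) ?orbT.
have {}fa : f a < 0 by rewrite lt_neqAle fa andbT; exact/eqP/f0.
have fb : 0 <= f b by rewrite -(nmulr_rle0 _ fa).
by rewrite ?fb ?(ltW fa) ?orbT.
Qed.

Lemma pairing_circ_sign p x v a b : S3 p -> S3 x -> dot v v = 1 -> dot x v = 0 ->
  (forall t, pairing p (circ x v t) <> 0) ->
  0 < pairing p (circ x v a) * pairing p (circ x v b).
Proof.
move=> Sp Sx v1 xv; apply: nonvanishing_sign => t.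
have E s : cross4 p (z p) (circ x v s) =
    circ (cross4 p (z p) x) (cross4 p (z p) v) s.
  by apply: row4P; rewrite /circ /cross4 /vec4 !mxE /=; ring.
rewrite (_ : (fun t => _) = fun t =>
    dot (circ (cross4 p (z p) x) (cross4 p (z p) v) t) (z (circ x v t))); last first.
  by apply/funext => s; rewrite -E dot_cross4.
have dc := is_derive_circ x v t.
exact: is_derive_continuous
  (is_derive_dot (is_derive_circ _ _ t) (is_derive_comp_curve (dz _) dc)).
Qed.

(** Any x off the leaf of p is moved to a unit normal of the leaf plane along the great circle from
    x to q, q being the normalised [cross4 p (z p) x]. The circle avoids the leaf, so the sign is
    kept. *)
Lemma exists_normal p x : S3 p -> S3 x -> pairing p x <> 0 ->
  exists q, [/\ S3 q, dot q p = 0, dot q (z p) = 0 &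
    0 < pairing p x * pairing p q].
Proof.
move=> Sp Sx Dx; have [p1 z1 pz] := on Sp.
pose q0 := cross4 p (z p) x.
have [qp qz qx] := det4_repeat p (z p) x; rewrite -!dot_cross4 -/q0 in qp qz qx.
have q00 : dot q0 q0 <> 0.
  by move=> /dot_eq0 E; apply: Dx; rewrite /pairing -dot_cross4 -/q0 E dot0l.
pose s := Num.sqrt (dot q0 q0).
have ss : s * s = dot q0 q0 by rewrite -expr2 sqr_sqrtr// dot_ge0.
have s0 : s != 0 by apply/eqP => s0; apply: q00; rewrite -ss s0 mulr0.
pose q := s^-1 *: q0.
have q1 : dot q q = 1 by rewrite /q !dotL -ss; field.
have xq : dot x q = 0 by rewrite /q !dotL dotC qx mulr0.
exists q; split; rewrite /q ?dotL ?qp ?qz ?mulr0//.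
have -> : x = circ x q 0 by rewrite circ0.
have -> : s^-1 *: q0 = circ x q (pi / 2).
  by rewrite /circ cos_pihalf sin_pihalf scale0r scale1r add0r.
rewrite circ0; have := @pairing_circ_sign p x q 0 (pi / 2) Sp Sx q1 xq.
rewrite circ0; apply => t.
have Sc : S3 (circ x q t) by exact: dot_circ.
(* At cos t x, with sin t = 0, the point is detected by the normal m; elsewhere its component along
   q0 is nonzero. *)
have [st|st] := eqVneq (sin t) 0.
  pose m := cross4 p (z p) q.
  have [mp mz mq] := det4_repeat p (z p) q; rewrite -!dot_cross4 -/m in mp mz mq.
  apply: (@pairing_neq0 p _ m) => //; rewrite /circ st scale0r addr0 !dotL.
  rewrite dot_cross4 det4_swap -dot_cross4 -/q0 /q !dotL -ss.
  have ct : cos t != 0.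
    by apply/eqP => ct; have := cos_sin_sqr t; rewrite ct st; lra.
  by apply/eqP; rewrite mulrN oppr_eq0 !mulf_neq0// invr_neq0.
apply: (@pairing_neq0 p _ q0) => //; rewrite /circ /q !dotL qx -ss.
by apply/eqP; rewrite mulr0 add0r !mulf_neq0// invr_neq0.
Qed.

(** Explicit connectedness of the complement of a leaf: x and y are moved to unit normals of the
    leaf plane, and these normals form a great circle (spanned by q and m) disjoint from the
    leaf. *)
Lemma pairing_sign p x y : S3 p -> S3 x -> S3 y ->
  pairing p x <> 0 -> pairing p y <> 0 -> 0 < pairing p x * pairing p y.
Proof.
move=> Sp Sx Sy.
have [p1 z1 pz] := on Sp.
move=> Dx Dy.
have [q [Sq qp qz xq]] := exists_normal Sp Sx Dx.
have [r [Sr rp rz yr]] := exists_normal Sp Sy Dy.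
suff qr : 0 < pairing p q * pairing p r.
  have : 0 < (pairing p x * pairing p q) * (pairing p q * pairing p r)
           * (pairing p y * pairing p r) by apply: mulr_gt0 => //; exact: mulr_gt0.
  have -> : (pairing p x * pairing p q) * (pairing p q * pairing p r)
      * (pairing p y * pairing p r) = (pairing p x * pairing p y) *
      ((pairing p q) ^+ 2 * (pairing p r) ^+ 2) by ring.
  have [q0 r0] : pairing p q != 0 /\ pairing p r != 0.
    by split; apply/eqP => E; rewrite E ?mul0r ?mulr0 ltxx in qr.
  by rewrite pmulr_lgt0// mulr_gt0// exprn_even_gt0.
pose m := cross4 p (z p) q.
have [mp mz mq] := det4_repeat p (z p) q; rewrite -!dot_cross4 -/m in mp mz mq.
have m1 : dot m m = 1.
  by rewrite /m (rotate_norm (on Sp))// dotC.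
have qm : dot q m = 0 by rewrite dotC.
have rE : r = dot r q *: q + dot r m *: m.
  apply: (@in_plane _ q m r) => // n nq nm.
  suff -> : n = dot n p *: p + dot n (z p) *: z p.
    by rewrite !dotL !(dotC _ r) rp rz; ring.
  apply: (in_span (on Sp) (n := q)); rewrite ?(dotC _ q)//.
  - by move=> q0; move: Sq; rewrite /S3 q0 dot0l => /esym/eqP; rewrite oner_eq0.
  - by rewrite dotC.
  - by rewrite -/m dotC.
have [t [ta tb]] : exists t, cos t = dot r q /\ sin t = dot r m.
  apply: cos_sin_surjective; rewrite -[RHS]Sr {5}rE !dotL.
  by rewrite (dotC q r) (dotC m r).
have := @pairing_circ_sign p q m 0 t Sp Sq m1 qm.
rewrite circ0 /circ ta tb -rE; apply => s.
have Sc : S3 (circ q m s) by exact: dot_circ.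
have [ss|ss] := eqVneq (sin s) 0.
  apply: (@pairing_neq0 p _ q) => //; rewrite /circ ss scale0r addr0 !dotL Sq.
  by move=> cs; have := cos_sin_sqr s; rewrite ss -[cos s]mulr1 cs; lra.
apply: (@pairing_neq0 p _ m) => //; rewrite /circ !dotL mq m1.
by apply/eqP; rewrite mulr0 add0r mulr1.
Qed.

(* Gluck-Warner: disjointness of the leaves makes one of the two Gauss maps
   dominate the other. *)
Lemma pairing_orientation : exists2 d : R, d = 1 \/ d = -1 &
  forall p q, S3 p -> S3 q -> 0 <= d * pairing p q.
Proof.
(* The pairing depends only on the Gauss maps, hence only on the leaves of p and q. *)
have wE p q : pairing p q = 2^-1 *
    (\sum_k wedge 1 k p (z p) * wedge 1 k q (z q)
     - \sum_k wedge (-1) k p (z p) * wedge (-1) k q (z q)).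
  rewrite (wedge_dot _ _ _ _ (or_introl erefl)).
  by rewrite (wedge_dot _ _ _ _ (or_intror erefl)) /pairing; field.
have main : forall p q p1 q1, S3 p -> S3 q -> S3 p1 -> S3 q1 ->
    pairing p q <> 0 -> pairing p1 q1 <> 0 -> 0 < pairing p q * pairing p1 q1.
  move=> p q p1 q1 Sp Sq Sp1 Sq1 D D'.
  have tr (a b c : R) : b <> 0 -> 0 < a * b -> 0 < b * c -> 0 < a * c.
    move=> /eqP b0 ab bc; have : 0 < (a * b) * (b * c) by exact: mulr_gt0.
    have -> : a * b * (b * c) = a * c * b ^+ 2 by ring.
    by rewrite pmulr_lgt0// exprn_even_gt0.
  (* The signs at (p, q) and (p1, q1) are compared through (p, q1). If that pairing vanishes, p and
     q1 share a leaf and p can replace q1. *)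
  have [E|E] := pselect (pairing p q1 = 0).
    have E' : pairing p1 q1 = pairing p1 p.
      by rewrite !wE; under eq_bigr do rewrite -(same_leaf_wedge Sp Sq1 E);
         under [X in _ - X]eq_bigr do rewrite -(same_leaf_wedge Sp Sq1 E).
    by rewrite E' (pairingC p1 p); apply: pairing_sign => //; rewrite (pairingC p) -E'.
  apply: (tr _ _ _ E); first exact: pairing_sign.
  rewrite (pairingC p) (pairingC p1); apply: pairing_sign => //.
    by rewrite pairingC.
  by rewrite pairingC.
have [[p [q [Sp Sq D]]]|N] :=
    pselect (exists p q, [/\ S3 p, S3 q & pairing p q <> 0]); last first.
  exists 1; first by left.
  move=> p q Sp Sq; rewrite mul1r le_eqVlt; apply/orP; left; rewrite eq_sym.
  by apply/eqP; apply: contrapT => D; apply: N; exists p, q.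
have [D0|D0] := ltP 0 (pairing p q).
  exists 1; first by left.
  move=> p1 q1 Sp1 Sq1; rewrite mul1r; have [->//|/eqP D'] := eqVneq (pairing p1 q1) 0.
  by have := main p q p1 q1 Sp Sq Sp1 Sq1 D D'; rewrite pmulr_rgt0// => /ltW.
exists (-1); first by right.
have {}D0 : pairing p q < 0 by rewrite lt_neqAle D0 andbT; exact/eqP.
move=> p1 q1 Sp1 Sq1; rewrite mulN1r oppr_ge0.
have [->//|/eqP D'] := eqVneq (pairing p1 q1) 0.
by have := main p q p1 q1 Sp Sq Sp1 Sq1 D D'; rewrite nmulr_rgt0// => /ltW.
Qed.

End Leaves.

(** * The two Gauss maps *)

Section GaussMaps.
Context {R : realType}.
Notation V := 'rV[R]_4.
Variable z : V -> V.
Hypothesis (uz : unit_vector_field z).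
Hypothesis (zcirc : forall p t, S3 p -> z (circ p (z p) t) = circ (z p) (- p) t).
Hypothesis (dz : forall x, differentiable z x).
Implicit Types (p q x y v w : V) (e : R) (k : 'I_3).

Definition gauss e k p := wedge e k p (z p).

Definition dgauss e k p w := wedge e k w (z p) + wedge e k p ('D_w z p).

Lemma is_derive_gauss_circ e k p w (t : R) :
  is_derive t 1 (fun s => gauss e k (circ p w s))
    (dgauss e k (circ p w t) (circ w (- p) t)).
Proof.
have dc := is_derive_circ p w t.
exact: is_derive_wedge dc (is_derive_comp_curve (dz _) dc).
Qed.

Lemma gauss_norm e p : e = 1 \/ e = -1 -> S3 p ->
  \sum_k gauss e k p * gauss e k p = 1.
Proof.
move=> e1 Sp; have [zp z1] := uz Sp; rewrite wedge_dot// Sp z1 zp (dotC p) zp.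
by have [-> _ _] := det4_repeat p (z p) p;
  have -> : det4 p (z p) p (z p) = 0; [rewrite /det4; ring|ring].
Qed.

Lemma dgauss_orth e p w : e = 1 \/ e = -1 -> S3 p -> dot w w = 1 -> dot p w = 0 ->
  \sum_k gauss e k p * dgauss e k p w = 0.
Proof.
move=> e1 Sp w1 pw.
have Sc t : S3 (circ p w t) by exact: dot_circ.
have dg k := is_derive_gauss_circ e k p w 0; rewrite !circ0 in dg.
have d : is_derive (0 : R) 1
   (fun s => \sum_k gauss e k (circ p w s) * gauss e k (circ p w s))
   (2 * \sum_k gauss e k p * dgauss e k p w).
  under eq_fun do rewrite sum_I3.
  rewrite sum_I3; have d0 := dg 0; have d1 := dg 1; have d2 := dg 2.
  by apply: is_derive_eq; rewrite /GRing.scale/= !circ0; ring.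
move: d; rewrite (_ : (fun s => _) = cst 1); last first.
  by apply/funext => s; rewrite gauss_norm.
move=> d; have := is_derive_unique d (is_derive_cst _ _ _) => /eqP.
by rewrite mulf_eq0 pnatr_eq0 => /eqP.
Qed.

Lemma dgaussD e k p v w a b :
  dgauss e k p (a *: v + b *: w) = a * dgauss e k p v + b * dgauss e k p w.
Proof.
rewrite /dgauss.
have -> : 'D_(a *: v + b *: w) z p = a *: 'D_v z p + b *: 'D_w z p.
  by rewrite !deriveE// linearD !linearZ.
move: ('D_v z p) ('D_w z p) (z p) k => A B C.
by apply: forall_I3; rewrite /wedge /= !mxE; ring.
Qed.

(** Pair each differential with the corresponding part of w /\ z. Adding the two signs cancels all
    determinants and leaves 2 |w /\ z|^2 = 2, not 0. *)
Lemma dgauss_neq0 p w : S3 p -> dot w w = 1 -> dot w p = 0 -> dot w (z p) = 0 ->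
  (forall k, dgauss 1 k p w = 0) -> (forall k, dgauss (-1) k p w = 0) -> False.
Proof.
move=> Sp w1 wp wz d1 d2; have [zp zz] := uz Sp.
have H e : (forall k, dgauss e k p w = 0) ->
  \sum_k wedge e k w (z p) * wedge e k w (z p)
  + \sum_k wedge e k p ('D_w z p) * wedge e k w (z p) = 0.
  move=> de; rewrite -big_split /= big1// => k _; rewrite -mulrDl.
  by rewrite -/(dgauss e k p w) de mul0r.
have := H _ d1; have := H _ d2.
do 2 rewrite (wedge_dot _ _ _ _ (or_intror erefl)).
do 2 rewrite (wedge_dot _ _ _ _ (or_introl erefl)).
rewrite w1 zz wz (dotC (z p) w) wz (dotC p w) wp (dotC p (z p)) zp.
by lra.
Qed.

Lemma exists_unit_normal p v :
  exists w, [/\ dot w w = 1, dot w p = 0 & dot w v = 0].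
Proof.
pose M : 'M[R]_(4, 1 + 1) := row_mx p^T v^T.
have K0 : kermx M != 0.
  rewrite -mxrank_eq0 mxrank_ker subn_eq0 -ltnNge.
  exact: leq_ltn_trans (rank_leq_col M) _.
pose u := nz_row (kermx M).
have u0 : u != 0 by rewrite nz_row_eq0.
have : u *m M = 0 by apply/sub_kermxP; exact: nz_row_sub.
rewrite mul_mx_row -row_mx0 => /eq_row_mx[up uv].
pose s := Num.sqrt (dot u u).
have ss : s * s = dot u u by rewrite -expr2 sqr_sqrtr// dot_ge0.
have s0 : s != 0.
  apply/eqP => s0; move/eqP: u0; apply; apply: dot_eq0.
  by rewrite -ss s0 mulr0.
exists (s^-1 *: u); split; rewrite !dotL.
- by rewrite -ss; field.
- by rewrite /dot up mxE mulr0.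
- by rewrite /dot uv mxE mulr0.
Qed.

Variable d : R.
Hypothesis d1 : d = 1 \/ d = -1.
Hypothesis Hd : forall p q, S3 p -> S3 q -> 0 <= d * pairing z p q.

Let Nd1 : - d = 1 \/ - d = -1.
Proof. by case: d1 => ->; [right|left; rewrite opprK]. Qed.

(** From here on, [gauss d] is the dominated map a and [gauss (- d)] the dominating map b. *)
Lemma gauss_pairing p q : \sum_k gauss d k p * gauss d k q =
  \sum_k gauss (- d) k p * gauss (- d) k q + 2 * (d * pairing z p q).
Proof. by rewrite !wedge_dot// /pairing; ring. Qed.

Lemma gauss_contraction p q : S3 p -> S3 q ->
  \sum_k (gauss d k p - gauss d k q) * (gauss d k p - gauss d k q) <=
  \sum_k (gauss (- d) k p - gauss (- d) k q) * (gauss (- d) k p - gauss (- d) k q).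
Proof.
move=> Sp Sq.
have E e : e = 1 \/ e = -1 ->
    \sum_k (gauss e k p - gauss e k q) * (gauss e k p - gauss e k q) =
    2 - 2 * \sum_k gauss e k p * gauss e k q.
  move=> e1; have := gauss_norm e1 Sp; have := gauss_norm e1 Sq.
  by rewrite !sum_I3; lra.
rewrite !E// gauss_pairing; have := Hd Sp Sq; lra.
Qed.

Lemma dgauss_contraction p w : S3 p -> dot w w = 1 -> dot p w = 0 ->
  (forall k, dgauss (- d) k p w = 0) -> forall k, dgauss d k p w = 0.
Proof.
move=> Sp w1 pw H k.
have Sc t : S3 (circ p w t) by exact: dot_circ.
have dg e j : is_derive (0 : R) 1 (fun s => gauss e j (circ p w s) - gauss e j p)
    (dgauss e j p w).
  have := is_derive_gauss_circ e j p w 0; rewrite !circ0 => dd.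
  have := is_deriveB dd (is_derive_cst (gauss e j p) (0 : R) (1 : R)).
  by rewrite subr0; exact.
apply: (@derive_le_sqr R (fun s => gauss d k (circ p w s) - gauss d k p)
    (fun j s => gauss (- d) j (circ p w s) - gauss (- d) j p)) => //.
- by rewrite circ0 subrr.
- by move=> j; rewrite circ0 subrr.
- by move=> j; have := dg (- d) j; rewrite (H j).
move=> t; apply: le_trans (gauss_contraction (Sc t) Sp).
by rewrite (bigD1 k)//= lerDl sumr_ge0// => j _; rewrite -expr2 sqr_ge0.
Qed.

Lemma dgauss_inj p w : S3 p -> dot w w = 1 -> dot p w = 0 -> dot w (z p) = 0 ->
  (forall k, dgauss (- d) k p w = 0) -> False.
Proof.
move=> Sp w1 pw wz H; have H' := dgauss_contraction Sp w1 pw H.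
have wp : dot w p = 0 by rewrite dotC.
move: H H'; case: d1 => ->; rewrite ?opprK => H H'.
  exact: (dgauss_neq0 Sp w1 wp wz).
exact: (dgauss_neq0 Sp w1 wp wz).
Qed.

(** Otherwise N = B x y is nonzero, where B is the value of b at p. All derivatives of b are
    orthogonal to B and y, hence multiples of N, so some direction normal to the leaf is killed,
    against [dgauss_inj]. *)
Lemma gauss_critical p (y : 'I_3 -> R) : S3 p -> \sum_k y k * y k = 1 ->
  (forall w, dot w w = 1 -> dot p w = 0 -> \sum_k y k * dgauss (- d) k p w = 0) ->
  forall k, y k = (\sum_j y j * gauss (- d) j p) * gauss (- d) k p.
Proof.
move=> Sp y1 crit.
have B1 := gauss_norm Nd1 Sp.
pose B k := gauss (- d) k p.
have [w [w1 wp wz]] := exists_unit_normal p (z p).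
pose v := cross4 p (z p) w.
have [p1 z1 pz] : orthonormal_pair p (z p).
  by have [zp zz] := uz Sp; split=> //; rewrite dotC.
have [vp vz vw] := det4_repeat p (z p) w; rewrite -!dot_cross4 -/v in vp vz vw.
have v1 : dot v v = 1.
  by rewrite /v rotate_norm//; rewrite dotC.
pose n0 := B 1 * y 2 - B 2 * y 1; pose n1 := B 2 * y 0 - B 0 * y 2.
pose n2 := B 0 * y 1 - B 1 * y 0.
pose nn := n0 * n0 + n1 * n1 + n2 * n2.
have [nn0|nn0] := eqVneq nn 0; last first.
  exfalso.
  have par u : dot u u = 1 -> dot p u = 0 -> exists l, forall k,
      nn * dgauss (- d) k p u = l * match val k with 0 => n0 | 1 => n1 | _ => n2 end.
    move=> u1 pu; have c1 := crit u u1 pu; have c2 := dgauss_orth Nd1 Sp u1 pu.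
    rewrite sum_I3 in c1; rewrite sum_I3 in c2.
    have [e0 e1 e2] := parallel_cross c2 c1.
    by eexists; apply: forall_I3 => /=; [exact: e0|exact: e1|exact: e2].
  have [l Hl] := par w w1 (etrans (dotC _ _) wp).
  have [m Hm] := par v v1 (etrans (dotC _ _) vp).
  (* The derivatives along w and v have coefficients l and m on N; a nonzero (a, b) orthogonal to
     (l, m) gives the killed direction. *)
  have [a [b [ab0 ab]]] : exists a b, a * a + b * b <> 0 /\ a * l + b * m = 0.
    have [l0|l0] := eqVneq l 0.
      exists 1, 0; split; last by rewrite l0; ring.
      by rewrite mulr0 addr0 mulr1; exact/eqP/oner_neq0.
    exists m, (- l); split; last by ring.
    move=> /eqP; rewrite mulrNN paddr_eq0 -?expr2 ?sqr_ge0// => /andP[_].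
    by rewrite sqrf_eq0 (negbTE l0).
  pose s := Num.sqrt (a * a + b * b).
  have ss : s * s = a * a + b * b.
    by rewrite -expr2 sqr_sqrtr// addr_ge0// -expr2 sqr_ge0.
  have s0 : s != 0 by apply/eqP => s0; apply: ab0; rewrite -ss s0 mulr0.
  pose u := (a / s) *: w + (b / s) *: v.
  have u1 : dot u u = 1.
    rewrite /u !dotL w1 v1 vw (dotC w) vw.
    have -> : a / s * (a / s * 1 + b / s * 0) + b / s * (a / s * 0 + b / s * 1)
      = (a * a + b * b) / (s * s) by field.
    by rewrite ss divff//; exact/eqP.
  apply: (@dgauss_inj p u) => //.
  - by rewrite dotC /u !dotL wp vp; ring.
  - by rewrite /u !dotL wz vz; ring.
  move=> k; rewrite /u dgaussD; apply: (mulfI nn0).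
  exact: (combination_eq0 s (Hl k) (Hm k) ab).
have [e0 [e1 e2]] : n0 = 0 /\ n1 = 0 /\ n2 = 0.
  have q0 := sqr_ge0 n0; have q1 := sqr_ge0 n1; have q2 := sqr_ge0 n2.
  rewrite /nn -!expr2 in nn0.
  by split; [|split]; apply/eqP; rewrite -sqrf_eq0; apply/eqP; lra.
rewrite sum_I3 -/(B 0) -/(B 1) -/(B 2) in B1.
have t0 : n0 = 0 by []. have t1 : n1 = 0 by []. have t2 : n2 = 0 by [].
rewrite /n0 in t0; rewrite /n1 in t1; rewrite /n2 in t2.
(* The difference |B|^2 y - <y, B> B equals N x B, and N vanishes. *)
move=> k; rewrite sum_I3 -/(B 0) -/(B 1) -/(B 2) -/(B k) -[LHS]mul1r -B1.
move: k; apply: forall_I3; apply/eqP; rewrite -subr_eq0; apply/eqP.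
- transitivity (B 1 * (- (B 0 * y 1 - B 1 * y 0)) + B 2 * (B 2 * y 0 - B 0 * y 2));
    first by ring.
  by rewrite t1 t2; ring.
- transitivity (B 0 * (B 0 * y 1 - B 1 * y 0) - B 2 * (B 1 * y 2 - B 2 * y 1));
    first by ring.
  by rewrite t0 t2; ring.
- transitivity (B 1 * (B 1 * y 2 - B 2 * y 1) - B 0 * (B 2 * y 0 - B 0 * y 2));
    first by ring.
  by rewrite t0 t1; ring.
Qed.

Lemma continuous_gauss e k : continuous (fun p => gauss e k p).
Proof.
apply: continuous_wedge => p; first exact: cvg_id.
exact: differentiable_continuous.
Qed.

(** At a minimum p2 of <b(p1), b>, [gauss_critical] gives b(p1) = c b(p2) with c = 1 or -1. If c =
    1, the minimum is already 1, the largest value of a product of unit vectors, and b is constant,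
    against [dgauss_inj]. *)
Lemma gauss_antipode p1 : S3 p1 ->
  exists2 p2, S3 p2 & forall k, gauss (- d) k p2 = - gauss (- d) k p1.
Proof.
move=> Sp1; pose f p := \sum_k gauss (- d) k p1 * gauss (- d) k p.
have cf : continuous f.
  apply: continuous_sum3 => k; apply: continuous_mul; first exact: cst_continuous.
  exact: continuous_gauss.
have [p2 Sp2 fmin] := S3_min cf.
have crit w : dot w w = 1 -> dot p2 w = 0 ->
    \sum_k gauss (- d) k p1 * dgauss (- d) k p2 w = 0.
  move=> w1 pw.
  have dg k t := is_derive_gauss_circ (- d) k p2 w t.
  have df (t : R) : is_derive t 1 (fun t => f (circ p2 w t)) (\sum_k
      gauss (- d) k p1 * dgauss (- d) k (circ p2 w t) (circ w (- p2) t)).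
    rewrite /f; under eq_fun do rewrite sum_I3.
    rewrite sum_I3; have d0 := dg 0 t; have d1' := dg 1 t; have d2 := dg 2 t.
    by apply: is_derive_eq; rewrite /GRing.scale/=; ring.
  have := derivative_at_min df; rewrite !circ0; apply => t.
  by apply: fmin; exact: dot_circ.
have par := gauss_critical Sp2 (gauss_norm Nd1 Sp1) crit.
set c := \sum_j _ in par.
have c2 : c * c = 1.
  have := gauss_norm Nd1 Sp1; have := gauss_norm Nd1 Sp2; rewrite !sum_I3 => E2.
  rewrite !par => <-; rewrite -[LHS]mulr1 -E2; ring.
have : (c - 1) * (c + 1) = 0.
  by transitivity (c * c - 1); [ring|rewrite c2 subrr].
move/eqP; rewrite mulf_eq0 => /orP[/eqP c1|/eqP c1]; last first.
  exists p2 => // k; have cN : c = -1 by lra.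
  by rewrite (par k) cN; ring.
exfalso.
have constb p : S3 p -> forall k, gauss (- d) k p = gauss (- d) k p1.
  move=> Sp.
  have le1 : 1 <= f p by have := fmin p Sp; rewrite /f -/c; lra.
  have E : \sum_k (gauss (- d) k p - gauss (- d) k p1) ^+ 2 <= 0.
    have := gauss_norm Nd1 Sp; have := gauss_norm Nd1 Sp1; move: le1.
    by rewrite /f !sum_I3; lra.
  have := E; rewrite sum_I3 => E'.
  have q0 := sqr_ge0 (gauss (- d) 0 p - gauss (- d) 0 p1).
  have q1 := sqr_ge0 (gauss (- d) 1 p - gauss (- d) 1 p1).
  have q2 := sqr_ge0 (gauss (- d) 2 p - gauss (- d) 2 p1).
  by apply: forall_I3; apply/eqP; rewrite -subr_eq0 -sqrf_eq0; apply/eqP; lra.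
have [w [w1 wp wz]] := exists_unit_normal p2 (z p2).
have pw : dot p2 w = 0 by rewrite dotC.
apply: (dgauss_inj Sp2 w1 pw wz) => k.
have := is_derive_gauss_circ (- d) k p2 w 0; rewrite !circ0 => dk.
apply: (is_derive_unique dk).
rewrite (_ : (fun s => _) = cst (gauss (- d) k p1)); last first.
  by apply/funext => s; rewrite constb//; exact: dot_circ.
exact: is_derive_cst.
Qed.

(** If both determinants left after the cancellation vanish, p lies on the leaves of p1 and p2; then
    b(p) equals b(p1) and b(p2) = - b(p1), so the unit vector b(p) would be 0. *)
Lemma gauss_hemisphere : exists n : 'I_3 -> R,
  forall p, S3 p -> 0 < \sum_k n k * gauss d k p.
Proof.
have [p1 Sp1] := @S3_nonempty R; have [p2 Sp2 anti] := gauss_antipode Sp1.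
exists (fun k => gauss d k p1 + gauss d k p2) => p Sp.
have E : \sum_k (gauss d k p1 + gauss d k p2) * gauss d k p =
    2 * (d * pairing z p1 p) + 2 * (d * pairing z p2 p).
  under eq_bigr do rewrite mulrDl; rewrite big_split/= !gauss_pairing.
  by rewrite !sum_I3 !anti; ring.
rewrite E; have h1 := Hd Sp1 Sp; have h2 := Hd Sp2 Sp.
rewrite lt_neqAle; apply/andP; split; last by lra.
apply/eqP => E0.
have d0 : d != 0 by case: d1 => ->; rewrite ?oppr_eq0 oner_neq0.
have pr q : d * pairing z q p = 0 -> pairing z q p = 0.
  by move/eqP; rewrite mulf_eq0 (negbTE d0) => /eqP.
have e1 : pairing z p1 p = 0 by apply: pr; lra.
have e2 : pairing z p2 p = 0 by apply: pr; lra.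
have w1 := same_leaf_wedge uz zcirc Sp1 Sp e1 (- d).
have w2 := same_leaf_wedge uz zcirc Sp2 Sp e2 (- d).
have := gauss_norm Nd1 Sp; rewrite big1 => [/esym/eqP|k _]; first by rewrite oner_eq0.
have g1 : gauss (- d) k p1 = gauss (- d) k p by exact: w1.
have g2 : gauss (- d) k p2 = gauss (- d) k p by exact: w2.
have := anti k; rewrite g1 g2 => Z.
by have -> : gauss (- d) k p = 0; [lra|rewrite mul0r].
Qed.

End GaussMaps.

(** * Calculus in the quaternionic frame *)

Section FrameCalculus.
Context {R : realType}.
Notation V := 'rV[R]_4.
Implicit Types (p q x y v w : V) (e : R) (k : 'I_3).

Lemma frame_lin k a b p q :
  frame k (a *: p + b *: q) = a *: frame k p + b *: frame k q.
Proof.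
by move: k; apply: forall_I3; rewrite /frame /=; apply: row4P;
  rewrite /vec4 !mxE /=; ring.
Qed.

Lemma frame_frame k p : frame k (frame k p) = - p.
Proof.
by move: k; apply: forall_I3; rewrite /frame /=; apply: row4P;
  rewrite /vec4 !mxE /=; ring.
Qed.

Lemma dot_frame k p : dot (frame k p) p = 0.
Proof.
by move: k; apply: forall_I3; rewrite /frame /= dotE /vec4 !mxE /=; ring.
Qed.

Lemma dot_frame2 k p : dot (frame k p) (frame k p) = dot p p.
Proof.
by move: k; apply: forall_I3; rewrite /frame /= !dotE /vec4 !mxE /=; ring.
Qed.

Lemma frame_expansion p v : dot p p = 1 ->
  v = dot v p *: p + \sum_k dot v (frame k p) *: frame k p.
Proof.
move=> p1; rewrite -[LHS]scale1r -p1 sum_I3.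
by apply: row4P; rewrite !dotE /frame /vec4 !mxE /=; ring.
Qed.

Lemma frame_bessel p q : dot p p = 1 -> dot q q = 1 ->
  \sum_k dot (frame k p) q * dot (frame k p) q = 1 - dot p q * dot p q.
Proof.
move=> p1 q1; rewrite -[in RHS](mulr1 1) -{1}p1 -q1 sum_I3.
by rewrite !dotE /frame /vec4 !mxE /=; ring.
Qed.

Lemma continuous_frame k : continuous (frame k : V -> V).
Proof.
apply: (@lipschitz_continuous _ _ _ _ 1) => // p q; rewrite mul1r.
have -> : frame k p - frame k q = frame k (p - q).
  by have := frame_lin k 1 (-1) p q; rewrite !scale1r !scaleN1r.
apply: le_norm_row => // j.
by move: k; apply: forall_I3; move: j; apply: forall_I4;
  rewrite /frame /vec4 mxE /= ?normrN norm_coord_le.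
Qed.

Lemma frame_circ k p t : circ (frame k p) (- p) t = frame k (circ p (frame k p) t).
Proof. by rewrite /circ frame_lin frame_frame. Qed.

Lemma is_derive_frame_circ k p (t : R) :
  is_derive t 1 (circ p (frame k p)) (frame k (circ p (frame k p) t)).
Proof. by rewrite -frame_circ; exact: is_derive_circ. Qed.

Lemma is_derive_frame k (c : R -> V) (t : R) v :
  is_derive t 1 c v -> is_derive t 1 (fun s => frame k (c s)) (frame k v).
Proof.
move=> dc; have dC j := is_derive_coord j dc; apply: is_derive_row.
have dN j : is_derive t 1 (fun s => - c s 0 j) (- v 0 j) by exact: is_deriveN.
move: k; apply: forall_I3; apply: forall_I4; rewrite /frame /vec4 /= mxE /=;
  by under eq_fun do rewrite mxE /=.
Qed.

Lemma derive_line (W : normedModType R) (F : V -> W) p v (a : W) :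
  is_derive (0 : R) 1 (fun s : R => F (p + s *: v)) a -> 'D_v F p = a.
Proof.
move=> [_ <-]; rewrite /derive.
have E : (fun h : R => h^-1 *: ((F \o shift p) (h *: v) - F p)) =
  (fun h : R => h^-1 *: (((fun s => F (p + s *: v)) \o shift 0) (h *: 1)
                         - F (p + 0 *: v))).
  apply/funext => h /=; rewrite scale0r !addr0 (addrC p).
  by congr (_ *: (F (_ *: _ + _) - _)); rewrite /GRing.scale/= mulr1.
by rewrite E.
Qed.

Lemma is_derive_line p v (s : R) : is_derive s 1 (fun s : R => p + s *: v) v.
Proof.
have d := is_deriveD (is_derive_cst p s (1 : R)) (is_derive_scalel v (is_derive_id s 1)).
by move: d; rewrite add0r scale1r.
Qed.

Lemma wedgeDr e i x y v : wedge e i x (y + v) = wedge e i x y + wedge e i x v.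
Proof. by move: i; apply: forall_I3; rewrite /wedge /= !mxE; ring. Qed.

Lemma wedgeZr e i a x y : wedge e i x (a *: y) = a * wedge e i x y.
Proof. by move: i; apply: forall_I3; rewrite /wedge /= !mxE; ring. Qed.

Lemma wedgeC e i x y : wedge e i y x = - wedge e i x y.
Proof. by move: i; apply: forall_I3; rewrite /wedge /=; ring. Qed.

Lemma wedge_self e i x : wedge e i x x = 0.
Proof. by move: i; apply: forall_I3; rewrite /wedge /=; ring. Qed.

Lemma wedgeNl e i x y : wedge e i (- x) y = - wedge e i x y.
Proof. by move: i; apply: forall_I3; rewrite /wedge /= !mxE; ring. Qed.

(* (p, v_0, v_1, v_2) is a positively oriented orthonormal basis. *)
Lemma wedge_frame e i p : e = 1 \/ e = -1 ->
  [/\ wedge e i (frame 0 p) (frame 1 p) = e * wedge e i p (frame 2 p),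
      wedge e i (frame 1 p) (frame 2 p) = e * wedge e i p (frame 0 p) &
      wedge e i (frame 2 p) (frame 0 p) = e * wedge e i p (frame 1 p)].
Proof.
by move=> [] ->; move: i; apply: forall_I3; split;
  rewrite /wedge /frame /vec4 /= !mxE /=; ring.
Qed.

(* T_lk = <y_k, v_l> annihilates z on both sides, hence its antisymmetric part
   is a multiple of the cross product with z: the curl is parallel to z. *)
Lemma curl_parallel e p z (y : 'I_3 -> V) : e = 1 \/ e = -1 ->
  dot p p = 1 -> dot z z = 1 -> dot z p = 0 ->
  (forall k, dot (y k) p = - dot z (frame k p)) ->
  (forall k, dot (y k) z = 0) ->
  \sum_k dot z (frame k p) *: y k = - p ->
  exists tau, forall i, \sum_k wedge e i (frame k p) (y k) = tau * wedge e i p z.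
Proof.
move=> e1 p1 z1 zp yp yz yz'.
pose T l k := dot (y k) (frame l p).
have [Z ZE] : exists Z, forall k, Z k = dot z (frame k p) by eexists.
have zE : z = Z 0 *: frame 0 p + Z 1 *: frame 1 p + Z 2 *: frame 2 p.
  by rewrite {1}(frame_expansion z p1) zp scale0r add0r sum_I3 !ZE.
have yE k : y k =
    - Z k *: p + (T 0 k *: frame 0 p + T 1 k *: frame 1 p + T 2 k *: frame 2 p).
  by rewrite {1}(frame_expansion (y k) p1) yp ZE sum_I3.
have Z1 : Z 0 * Z 0 + Z 1 * Z 1 + Z 2 * Z 2 = 1.
  by rewrite -z1 {2}zE !dotL -!ZE.
have r k : T 0 k * Z 0 + T 1 k * Z 1 + T 2 k * Z 2 = 0.
  by rewrite -(yz k) {1}zE !dotL /T; ring.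
have l j : T j 0 * Z 0 + T j 1 * Z 1 + T j 2 * Z 2 = 0.
  have <- : dot (\sum_k dot z (frame k p) *: y k) (frame j p) = 0.
    by rewrite yz' dotNl dotC dot_frame oppr0.
  by rewrite sum_I3 !dotL -!ZE /T; ring.
pose a01 := T 1 0 - T 0 1; pose a12 := T 2 1 - T 1 2; pose a20 := T 0 2 - T 2 0.
have h0 : a20 * Z 2 = a01 * Z 1 by rewrite /a20 /a01; have := r 0; have := l 0; lra.
have h1 : a01 * Z 0 = a12 * Z 2 by rewrite /a12 /a01; have := r 1; have := l 1; lra.
have h2 : a12 * Z 1 = a20 * Z 0 by rewrite /a20 /a12; have := r 2; have := l 2; lra.
pose c := a12 * Z 0 + a20 * Z 1 + a01 * Z 2.
have c0 : a12 = c * Z 0.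
  rewrite -[LHS]mulr1 -Z1 /c.
  transitivity (a12 * Z 0 * Z 0 + (a12 * Z 1) * Z 1 + (a12 * Z 2) * Z 2); first by ring.
  by rewrite h2 -h1; ring.
have c1 : a20 = c * Z 1.
  rewrite -[LHS]mulr1 -Z1 /c.
  transitivity (a20 * Z 1 * Z 1 + (a20 * Z 0) * Z 0 + (a20 * Z 2) * Z 2); first by ring.
  by rewrite h0 -h2; ring.
have c2 : a01 = c * Z 2.
  rewrite -[LHS]mulr1 -Z1 /c.
  transitivity (a01 * Z 2 * Z 2 + (a01 * Z 0) * Z 0 + (a01 * Z 1) * Z 1); first by ring.
  by rewrite h1 -h0; ring.
(* The component of [y k] along p contributes p /\ z, hence the 1; the symmetric part of T cancels
   in the wedge, and its antisymmetric part c z contributes e c through [wedge_frame]. *)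
exists (1 + e * c) => i.
have [w01 w12 w20] := wedge_frame i p e1.
have E k : wedge e i (frame k p) (y k) = Z k * wedge e i p (frame k p)
    + T 0 k * wedge e i (frame k p) (frame 0 p)
    + T 1 k * wedge e i (frame k p) (frame 1 p)
    + T 2 k * wedge e i (frame k p) (frame 2 p).
  rewrite {1}yE !(wedgeDr, wedgeZr) (wedgeC e i p); move: (wedge e i) => X; ring.
rewrite sum_I3 !E !wedge_self (wedgeC e i (frame 0 p) (frame 1 p)).
rewrite (wedgeC e i (frame 1 p) (frame 2 p)) (wedgeC e i (frame 2 p) (frame 0 p)).
rewrite w01 w12 w20 zE !(wedgeDr, wedgeZr).
transitivity (Z 0 * wedge e i p (frame 0 p) + Z 1 * wedge e i p (frame 1 p)
  + Z 2 * wedge e i p (frame 2 p) + e * (a01 * wedge e i p (frame 2 p)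
    + a12 * wedge e i p (frame 0 p) + a20 * wedge e i p (frame 1 p))).
  by rewrite /a01 /a12 /a20; ring.
by rewrite c0 c1 c2; ring.
Qed.

(** Multiplication by the imaginary quaternion g0 i + g1 j + g2 k, from the left for e = 1 and from
    the right for e = -1. *)
Definition hopf_mx (e g0 g1 g2 : R) : 'M[R]_4 := \matrix_(i, j)
  nth 0 (nth [::] [:: [:: 0; - g0; - g1; - g2]; [:: g0; 0; - (e * g2); e * g1];
    [:: g1; e * g2; 0; - (e * g0)]; [:: g2; - (e * g1); e * g0; 0]] i) j.

Lemma hopf_mx_complex_structure (e a b c : R) : e = 1 \/ e = -1 ->
  a * a + b * b + c * c = 1 ->
  hopf_mx e a b c *m (hopf_mx e a b c)^T = 1%:M /\
  hopf_mx e a b c *m hopf_mx e a b c = - 1%:M.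
Proof.
move=> e1 g1; have gN : - (a * a + b * b + c * c) = -1 by rewrite g1.
split; apply/matrixP; apply: forall_I4; apply: forall_I4;
  rewrite !mxE sum_I4 !mxE /=; case: e1 => E; rewrite ?E ?oppr0;
  first [by ring | by rewrite -[RHS]g1; ring | by rewrite -[RHS]gN; ring].
Qed.

End FrameCalculus.

(** * From the harmonic field equation to harmonic Gauss maps *)

Section Harmonic.
Context {R : realType}.
Notation V := 'rV[R]_4.
Variable z : V -> V.
Hypothesis (dz : forall x, differentiable z x).
Hypothesis (dDz : forall v x, differentiable (fun y => 'D_v z y) x).
Hypothesis (uz : unit_vector_field z).
Hypothesis (zcirc : forall p t, S3 p -> z (circ p (z p) t) = circ (z p) (- p) t).
Hypothesis (hz : harmonic_field z).
Implicit Types (p q x y v w : V) (e : R) (k i : 'I_3) (c : R -> V).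

Definition frame_derive k p := 'D_(frame k p) z p.

(** Leibniz formula for the derivative of [frame_derive k] at p along v. The direction [frame k p]
    varies with p, while smoothness speaks of iterated derivatives in constant directions, hence the
    expansion in the standard basis. *)
Definition frame_derive2 k p v := \sum_j ((frame k v) 0 j *: 'D_(delta_mx 0 j) z p
  + (frame k p) 0 j *: 'D_v (fun q => 'D_(delta_mx 0 j) z q) p).

Lemma frame_deriveE k p :
  frame_derive k p = \sum_j (frame k p) 0 j *: 'D_(delta_mx 0 j) z p.
Proof. exact: derive_coord_sum. Qed.

Lemma is_derive_frame_derive k c (t : R) v : is_derive t 1 c v ->
  is_derive t 1 (fun s => frame_derive k (c s)) (frame_derive2 k (c t) v).
Proof.
move=> dc; have dF := is_derive_frame k dc.
have dj j := is_derive_scale (is_derive_coord j dF)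
  (is_derive_comp_curve (dDz (delta_mx 0 j) (c t)) dc).
under eq_fun do rewrite frame_deriveE sum_I4.
rewrite /frame_derive2 sum_I4.
have d := is_deriveD (is_deriveD (is_deriveD (dj 0) (dj 1)) (dj 2)) (dj 3).
exact: d.
Qed.

Lemma derive_zp v p : dot v p = 0 -> dot v v = 1 -> S3 p ->
  dot ('D_v z p) p = - dot (z p) v /\ dot ('D_v z p) (z p) = 0.
Proof.
move=> vp v1 Sp; have pv : dot p v = 0 by rewrite dotC.
have Sc t : S3 (circ p v t) by exact: dot_circ.
have dc := is_derive_circ p v 0; rewrite circ0 in dc.
have dzc : is_derive (0 : R) 1 (fun s => z (circ p v s)) ('D_v z p).
  by have := is_derive_comp_curve (dz (circ p v 0)) dc; rewrite circ0.
have d1 := is_derive_dot dzc dc; have d2 := is_derive_dot dzc dzc.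
rewrite !circ0 in d1 d2.
have e1 : dot ('D_v z p) p + dot (z p) v = 0.
  apply: (is_derive_unique d1).
  rewrite (_ : (fun s => _) = cst 0); first exact: is_derive_cst.
  by apply/funext => s; exact: (uz (Sc s)).1.
have e2 : dot ('D_v z p) (z p) + dot (z p) ('D_v z p) = 0.
  apply: (is_derive_unique d2).
  rewrite (_ : (fun s => _) = cst 1); first exact: is_derive_cst.
  by apply/funext => s; exact: (uz (Sc s)).2.
by rewrite (dotC (z p) ('D_v z p)) in e2; split; lra.
Qed.

Lemma geodesic p : S3 p -> 'D_(z p) z p = - p.
Proof.
move=> Sp; have dc := is_derive_circ p (z p) 0; rewrite circ0 in dc.
have d1 : is_derive (0 : R) 1 (fun s => z (circ p (z p) s)) ('D_(z p) z p).
  by have := is_derive_comp_curve (dz (circ p (z p) 0)) dc; rewrite circ0.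
have d2 := is_derive_circ (z p) (- p) 0; rewrite circ0 in d2.
apply: (is_derive_unique d1).
by rewrite (_ : (fun s => _) = circ (z p) (- p))//; apply/funext => s; exact: zcirc.
Qed.

Lemma nabla_frame_frame k p : S3 p -> nabla (frame k) (frame k) p = 0.
Proof.
move=> Sp; rewrite /nabla.
have -> : 'D_(frame k p) (frame k) p = - p.
  apply: derive_line; rewrite -(frame_frame k p).
  exact: is_derive_frame (is_derive_line _ _ _).
by rewrite /tproj dotNl Sp scaleN1r opprK addNr.
Qed.

Lemma tproj_split p v w a b : exists nu,
  tproj p (w - (a *: p + - b *: v)) = w + b *: v + nu *: p.
Proof.
rewrite /tproj; set m := dot _ _; exists (- a - m).
by apply/rowP => j; rewrite !mxE; ring.
Qed.

(** The term along [frame k p] arises from differentiating the normal part removed by [tproj]. The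
    multiple of p is left unspecified, since wedging with p kills it. *)
Lemma nabla_nabla k p : S3 p -> exists nu,
  nabla (frame k) (nabla (frame k) z) p =
  frame_derive2 k p (frame k p) + dot (z p) (frame k p) *: frame k p + nu *: p.
Proof.
move=> Sp; set v := frame k p.
have vp : dot v p = 0 by exact: dot_frame.
have v1 : dot v v = 1 by rewrite dot_frame2.
pose l (s : R) : V := p + s *: v.
have dl := is_derive_line p v 0.
have l0 : l 0 = p by rewrite /l scale0r addr0.
have dW := is_derive_frame_derive k dl.
have dd := is_derive_dot dW dl.
have dT := is_deriveB dW (is_derive_scale dd dl).
rewrite -/(l 0) l0 in dT.
have -> : nabla (frame k) (nabla (frame k) z) p = tproj p
    (frame_derive2 k p v - ((dot (frame_derive2 k p v) p + dot (frame_derive k p) v) *: p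
     + dot (frame_derive k p) p *: v)).
  rewrite {1}/nabla; congr (tproj p _); apply: derive_line; exact: dT.
rewrite (derive_zp vp v1 Sp).1; exact: tproj_split.
Qed.

(** The harmonic equation enters here: modulo p, the Euclidean trace differs from the rough
    Laplacian by the sum of <z, v_k> v_k, which is z itself. *)
Lemma harmonic_trace p : S3 p -> exists nu kappa,
  \sum_k frame_derive2 k p (frame k p) = nu *: p + kappa *: z p.
Proof.
move=> Sp; have := hz Sp; rewrite /rough_laplacian.
have /choice[nu Hnu] := fun k => nabla_nabla k Sp.
under eq_bigr => k _.
  rewrite Hnu {1}/nabla nabla_frame_frame// derive0.
  have -> : tproj p 0 = 0 by rewrite /tproj dot0l scale0r subr0.
  rewrite subr0; over.
rewrite big_split/= big_split/= -scaler_suml.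
have := frame_expansion (z p) Sp; rewrite (uz Sp).1 scale0r add0r => <-.
set S := \sum_k frame_derive2 k p _; set n := \sum_i _; set m := nabla_sqnorm z p.
move=> E; exists (- n), (- 1 - m).
have -> : S = S + z p + n *: p + m *: z p - z p - n *: p - m *: z p.
  by apply/rowP => j; rewrite !mxE; ring.
by rewrite E; apply/rowP => j; rewrite !mxE; ring.
Qed.

(** Second derivative of the Gauss map along the great circle leaving p in the direction
    [frame k p]. Great circles are geodesics, so the sum over k is the Laplacian of S^3. *)
Definition gauss_dd e i k p := - wedge e i p (z p)
  + 2 * wedge e i (frame k p) (frame_derive k p)
  + wedge e i p (frame_derive2 k p (frame k p)).

Lemma is_derive_gauss_frame e i k p (t : R) :
  is_derive t 1 (fun s => gauss z e i (circ p (frame k p) s))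
    (dgauss z e i (circ p (frame k p) t) (frame k (circ p (frame k p) t))).
Proof. by rewrite -frame_circ; exact: is_derive_gauss_circ. Qed.

Lemma is_derive2_gauss_frame e i k p : is_derive (0 : R) 1
  (fun t => dgauss z e i (circ p (frame k p) t) (frame k (circ p (frame k p) t)))
  (gauss_dd e i k p).
Proof.
have dc := is_derive_frame_circ k p 0.
have dF := is_derive_frame k dc.
have dzc := is_derive_comp_curve (dz _) dc.
have dW := is_derive_frame_derive k dc.
have d := is_deriveD (is_derive_wedge e i dF dzc) (is_derive_wedge e i dc dW).
rewrite !circ0 in d.
rewrite /dgauss; apply: (is_derive_eq d).
rewrite /gauss_dd frame_frame -/(frame_derive k p).
rewrite wedgeNl; by move: (wedge e i) => X; ring.
Qed.

(** Each term of [gauss_dd] sums to a multiple of p /\ z: -3 from the three directions, 2 tau from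
    the curl, and kappa from the trace of the second derivatives. *)
Lemma gauss_laplacian e p : e = 1 \/ e = -1 -> S3 p ->
  exists L, forall i, \sum_k gauss_dd e i k p = L * gauss z e i p.
Proof.
move=> e1 Sp; have [nu [kappa tr]] := harmonic_trace Sp.
have [zp z1] := uz Sp.
have [|||tau Htau] := @curl_parallel R e p (z p) (frame_derive ^~ p) e1 Sp z1 zp.
- by move=> k; apply: (derive_zp _ _ Sp).1; rewrite ?dot_frame2 ?dot_frame.
- by move=> k; apply: (derive_zp _ _ Sp).2; rewrite ?dot_frame2 ?dot_frame.
- rewrite -(geodesic Sp) [X in 'D_X _ _](frame_expansion (z p) Sp) zp scale0r add0r.
  rewrite deriveE// linear_sum; apply: eq_bigr => k _.
  by rewrite linearZ/= /frame_derive deriveE.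
exists (kappa - 3 + 2 * tau) => i; rewrite /gauss_dd !big_split/= -mulr_sumr Htau.
have -> : \sum_k wedge e i p (frame_derive2 k p (frame k p)) =
    wedge e i p (\sum_k frame_derive2 k p (frame k p)).
  by rewrite !sum_I3 !wedgeDr.
rewrite tr wedgeDr !wedgeZr wedge_self sum_I3 /gauss.
by move: (wedge e i p (z p)) => X; ring.
Qed.

Definition energy e p := \sum_i \sum_k (dgauss z e i p (frame k p)) ^+ 2.

(** The factor L is identified without computing it: differentiating |gauss|^2 = 1 twice and summing
    over the frame gives energy + L = 0. *)
Lemma gauss_harmonic_map e p i : e = 1 \/ e = -1 -> S3 p ->
  \sum_k gauss_dd e i k p = - energy e p * gauss z e i p.
Proof.
move=> e1 Sp; have [L HL] := gauss_laplacian e1 Sp.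
suff -> : - energy e p = L by exact: HL.
have Ek k : \sum_i ((dgauss z e i p (frame k p)) ^+ 2
    + gauss z e i p * gauss_dd e i k p) = 0.
  have v1 : dot (frame k p) (frame k p) = 1 by rewrite dot_frame2.
  have pv : dot p (frame k p) = 0 by rewrite dotC dot_frame.
  have Sc t : S3 (circ p (frame k p) t) by exact: dot_circ.
  have zero t : \sum_i gauss z e i (circ p (frame k p) t) *
      dgauss z e i (circ p (frame k p) t) (frame k (circ p (frame k p) t)) = 0.
    apply: dgauss_orth => //; first by rewrite dot_frame2; exact: Sc.
    by rewrite dotC dot_frame.
  have d j := is_deriveM (is_derive_gauss_frame e j k p 0)
                         (is_derive2_gauss_frame e j k p).
  have dS := is_deriveD (is_deriveD (d 0) (d 1)) (d 2).
  rewrite !circ0 in dS.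
  have dz0 : is_derive (0 : R) 1 (cst (0 : R) : R -> R) 0 by exact: is_derive_cst.
  rewrite sum_I3; apply: (is_derive_unique _ dz0).
  rewrite (_ : cst 0 = fun t => \sum_i gauss z e i (circ p (frame k p) t) *
      dgauss z e i (circ p (frame k p) t) (frame k (circ p (frame k p) t))); last first.
    by apply/funext => t; rewrite zero.
  under eq_fun do rewrite sum_I3.
  apply: (is_derive_eq dS); rewrite /GRing.scale/=; ring.
have := gauss_norm uz e1 Sp => N.
have H : \sum_k \sum_i ((dgauss z e i p (frame k p)) ^+ 2
    + gauss z e i p * gauss_dd e i k p) = 0 by rewrite big1.
rewrite exchange_big /= in H.
have {}H : energy e p + \sum_i gauss z e i p * \sum_k gauss_dd e i k p = 0.
  rewrite -[RHS]H /energy -big_split/=; apply: eq_bigr => j _.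
  by rewrite mulr_sumr -big_split.
apply/eqP; rewrite eq_sym -addr_eq0 addrC; apply/eqP; rewrite -[RHS]H; congr (_ + _).
rewrite -[LHS]mulr1 -N mulr_sumr; apply: eq_bigr => j _.
by rewrite HL; ring.
Qed.

End Harmonic.

(** * Strong maximum principle *)

Section MaximumPrinciple.
Context {R : realType}.
Notation V := 'rV[R]_4.
Variable z : V -> V.
Hypothesis (dz : forall x, differentiable z x).
Hypothesis (dDz : forall v x, differentiable (fun y => 'D_v z y) x).
Hypothesis (uz : unit_vector_field z).
Hypothesis (zcirc : forall p t, S3 p -> z (circ p (z p) t) = circ (z p) (- p) t).
Hypothesis (hz : harmonic_field z).
Variable e : R.
Hypothesis e1 : e = 1 \/ e = -1.
Implicit Types (p q x y v w : V) (k i : 'I_3) (c : R -> V).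

Lemma continuous_energy : continuous (energy z e).
Proof.
rewrite /energy; apply: continuous_sum3 => i; apply: continuous_sum3 => k.
have cW : continuous (fun p => 'D_(frame k p) z p).
  rewrite (_ : (fun p => _) = fun p => \sum_j (frame k p) 0 j *: 'D_(delta_mx 0 j) z p);
    last by apply/funext => p; exact: derive_coord_sum.
  under eq_fun do rewrite sum_I4.
  have T j : continuous (fun p => (frame k p) 0 j *: 'D_(delta_mx 0 j) z p).
    apply: continuous_scale; first by apply: continuous_coord; exact: continuous_frame.
    by move=> p; exact: differentiable_continuous (dDz _ p).
  exact: (continuous_addv (continuous_addv (continuous_addv (T 0) (T 1)) (T 2)) (T 3)).
have cz : continuous z by move=> p; exact: differentiable_continuous.
have cg : continuous (fun p => dgauss z e i p (frame k p)).
  apply: continuous_add; apply: continuous_wedge => //; last by move=> p; exact: cvg_id.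
  exact: continuous_frame.
exact: (continuous_mul cg cg).
Qed.

Lemma expR_circ p v q (a : R) (t : R) :
  is_derive t 1 (fun s => expR (a * dot (circ p v s) q))
    (a * dot (circ v (- p) t) q * expR (a * dot (circ p v t) q)).
Proof.
have d1 : is_derive t 1 (fun s => dot (circ p v s) q) (dot (circ v (- p) t) q).
  have := is_derive_dot (is_derive_circ p v t) (is_derive_cst q t (1 : R)).
  by rewrite (dotC _ 0) dot0l addr0.
have d2 := @is_deriveZ _ _ _ _ a t 1 _ d1.
rewrite mulrC.
exact: (@is_derive1_comp _ expR (fun s => a * dot (circ p v s) q) t _ _
  (is_derive_expR _) d2).
Qed.

Lemma is_derive2_expR_circ p v q (a : R) : is_derive (0 : R) 1
  (fun t => a * dot (circ v (- p) t) q * expR (a * dot (circ p v t) q))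
  (expR (a * dot p q) * (a ^+ 2 * (dot v q * dot v q) - a * dot p q)).
Proof.
have d1 : is_derive (0 : R) 1 (fun s => dot (circ v (- p) s) q) (- dot p q).
  have := is_derive_dot (is_derive_circ v (- p) 0) (is_derive_cst q 0 (1 : R)).
  by rewrite circ0 (dotC _ 0) dot0l addr0 dotNl.
have d := is_deriveM (@is_deriveZ _ _ _ _ a (0 : R) (1 : R) _ d1) (expR_circ p v q a 0).
rewrite !circ0 in d; apply: (is_derive_eq d);
rewrite /GRing.scale/= !circ0 /GRing.scale/=.
by move: (expR _) => X; ring.
Qed.

(* A positive superharmonic h = <n, gauss> is harmonic: otherwise subtract a
   small multiple of exp(a <p, q>), which is strictly subharmonic away from q,
   near which h is strictly superharmonic, and look at a minimum. *)
Lemma energy_eq0 (n : 'I_3 -> R) :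
  (forall p, S3 p -> 0 < \sum_i n i * gauss z e i p) ->
  forall q, S3 q -> energy z e q = 0.
Proof.
set h := fun p => \sum_i n i * gauss z e i p => h0 q Sq; apply/eqP/negPn/negP => Eq0.
have E0 p : 0 <= energy z e p by do 2 apply: sumr_ge0 => ? _; exact: sqr_ge0.
pose g p := energy z e p * h p.
have ch : continuous h.
  apply: continuous_sum3 => i; apply: continuous_mul; first exact: cst_continuous.
  exact: continuous_gauss.
have cg : continuous g by exact: continuous_mul continuous_energy ch.
have gq : 0 < g q by rewrite mulr_gt0 ?h0// lt_neqAle eq_sym Eq0 E0.
pose dl := g q / 2.
have dl0 : 0 < dl by rewrite divr_gt0.
have [r [r0 r1 Hr]] : exists r : R, [/\ 0 < r, r <= 1 &
    forall p, `|q - p| < r -> dl < g p].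
  have /cvgrPdist_lt /(_ dl dl0) := cg q.
  move=> /nbhs_ballP[r /= r0 Hr].
  exists (Num.min r 1); split; first by rewrite lt_min r0 ltr01.
    by rewrite ge_min lexx orbT.
  move=> p; rewrite lt_min => /andP[pr _].
  have := Hr p; rewrite -ball_normE /= => /(_ pr).
  by rewrite ltr_norml /dl => /andP[_]; lra.
(* On S^3, |p - q|^2 = 2 - 2 <p, q>, so <p, q> > s0 means Euclidean distance below r, which bounds
   the sup norm too. *)
pose s0 := 1 - r * r / 2.
have rr : 0 < r * r <= 1 by rewrite mulr_gt0//= mulr_ile1// ltW.
have near_q p : S3 p -> s0 < dot p q -> dl < g p.
  move=> Sp sp; apply: Hr.
  have N : dot (q - p) (q - p) < r ^+ 2.
    by rewrite !dotL (dotC q p) Sp Sq expr2; move: sp; rewrite /s0; lra.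
  have coord j : `|(q - p) 0 j| < r.
    have r0' := ltW r0; rewrite -ltr_sqr ?nnegrE// real_normK ?num_real//.
    apply: le_lt_trans N; rewrite dotE -!expr2; move: j.
    have S2 j := sqr_ge0 ((q - p) 0 j).
    have := S2 0; have := S2 1; have := S2 2; have := S2 3.
    by move=> ? ? ? ?; apply: forall_I4; lra.
  rewrite [ltLHS]/Num.Def.normr/= mx_normrE.
  by apply: bigmax_lt => // -[i j] _; rewrite ord1; exact: coord.
(* The Laplacian of exp(a s), s = <p, q>, is a exp(a s) (a (1 - s^2) - 3 s). With a (1 - s0^2) = 4 >
   3 it is positive at every point with s <= s0. *)
pose a := 4 / (1 - s0 ^+ 2).
have s01 : 0 < 1 - s0 ^+ 2.
  have -> : 1 - s0 ^+ 2 = (1 - s0) * (1 + s0) by ring.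
  by apply: mulr_gt0; rewrite /s0; lra.
have a0 : 0 < a by rewrite divr_gt0.
have aE : a * (1 - s0 ^+ 2) = 4 by rewrite /a; field; rewrite gt_eqF.
(* Near q the Laplacian of the exponential is at least - 3 a exp(a), so that of its [ep] multiple is
   at least - dl. *)
pose ep := dl / (3 * a * expR a).
have D0 : 0 < 3 * a * expR a.
  by apply: mulr_gt0; [exact: mulr_gt0|exact: expR_gt0].
have ep0 : 0 < ep by exact: divr_gt0.
have epE : ep * (3 * a * expR a) = dl by rewrite /ep divfK// gt_eqF.
pose f p := h p - ep * expR (a * dot p q).
have cf : continuous f.
  apply: continuous_add => //; apply: continuous_opp; apply: continuous_mul.
    exact: cst_continuous.
  have cd : continuous (fun p => a * dot p q).
    apply: continuous_mul; first exact: cst_continuous.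
    by apply: continuous_dot; [move=> p; exact: cvg_id|exact: cst_continuous].
  by move=> p; apply: (continuous_comp (cd p)); exact: continuous_expR.
have [p Sp fmin] := S3_min cf.
set s := dot p q.
pose d2 k := \sum_i n i * gauss_dd z e i k p
  - ep * (expR (a * s) * (a ^+ 2 * (dot (frame k p) q * dot (frame k p) q) - a * s)).
have d2_ge0 k : 0 <= d2 k.
  have dG i t := is_derive_gauss_frame dz e i k p t.
  have dG2 i := is_derive2_gauss_frame dz dDz e i k p.
  pose df (t : R) := \sum_i n i * dgauss z e i (circ p (frame k p) t)
      (frame k (circ p (frame k p) t))
    - ep * (a * dot (circ (frame k p) (- p) t) q * expR (a * dot (circ p (frame k p) t) q)).
  have D1 (t : R) : is_derive t 1 (fun t => f (circ p (frame k p) t)) (df t).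
    rewrite /f /h /df; under eq_fun do rewrite sum_I3; rewrite sum_I3.
    have dZ i := @is_deriveZ _ _ _ _ (n i) t 1 _ (dG i t).
    have dE := @is_deriveZ _ _ _ _ ep t 1 _ (expR_circ p (frame k p) q a t).
    have d := is_deriveB (is_deriveD (is_deriveD (dZ 0) (dZ 1)) (dZ 2)) dE.
    exact: d.
  have D2 : is_derive (0 : R) 1 df (d2 k).
    rewrite /df /d2; under eq_fun do rewrite sum_I3; rewrite sum_I3.
    have dZ i := @is_deriveZ _ _ _ _ (n i) (0 : R) (1 : R) _ (dG2 i).
    have dE := @is_deriveZ _ _ _ _ ep (0 : R) (1 : R) _ (is_derive2_expR_circ p (frame k p) q a).
    have d := is_deriveB (is_deriveD (is_deriveD (dZ 0) (dZ 1)) (dZ 2)) dE.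
    exact: d.
  apply: (second_derivative_at_min D1 D2) => t; rewrite circ0; apply: fmin.
  apply: dot_circ => //; first by rewrite dot_frame2.
  by rewrite dotC dot_frame.
have bess : \sum_k dot (frame k p) q * dot (frame k p) q = 1 - s * s.
  exact: frame_bessel.
have lap : \sum_k \sum_i n i * gauss_dd z e i k p = - g p.
  rewrite exchange_big /=; under eq_bigr => i _.
    rewrite -mulr_sumr gauss_harmonic_map// mulrCA; over.
  by rewrite -mulr_sumr mulNr.
(* At the minimum of f the three second derivatives are nonnegative; this is their sum. *)
have total : 0 <= - g p - ep * expR (a * s) * (a * (a * (1 - s * s) - 3 * s)).
  have : 0 <= \sum_k d2 k by apply: sumr_ge0.
  rewrite /d2 sumrB lap -bess !sum_I3.
  by move: (expR _) => X; congr (0 <= _); ring.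
have s2 : -1 <= s <= 1.
  have : 0 <= 1 - s * s by rewrite -bess; apply: sumr_ge0 => k _; rewrite -expr2 sqr_ge0.
  by move=> H; rewrite -ler_norml -ler_sqr ?nnegrE// real_normK ?num_real// expr1n expr2; lra.
have X0 : 0 < expR (a * s) by exact: expR_gt0.
have gp0 : 0 <= g p by rewrite mulr_ge0// ltW// h0.
(* Away from q the exponential makes the sum negative; near q the bound g p > dl outweighs its
   contribution. *)
have [ss|ss] := leP s s0.
  have pos : 0 < a * (1 - s * s) - 3 * s.
    have ns : 0 <= 1 - s * s.
      have -> : 1 - s * s = (1 - s) * (1 + s) by ring.
      by apply: mulr_ge0; lra.
    have [s_neg|s_pos] := ltP s 0.
      have : 0 <= a * (1 - s * s) by rewrite mulr_ge0// ltW.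
      lra.
    have le_s : s * s <= s0 ^+ 2 by rewrite expr2 ler_pM.
    have : a * (1 - s0 ^+ 2) <= a * (1 - s * s) by rewrite (ler_wpM2l (ltW a0))//; lra.
    by rewrite aE; lra.
  have : 0 < ep * expR (a * s) * (a * (a * (1 - s * s) - 3 * s)).
    by apply: mulr_gt0; exact: mulr_gt0.
  lra.
have gp := near_q p Sp ss.
have le_exp : expR (a * s) <= expR a.
  by rewrite ler_expR -[leRHS]mulr1 (ler_wpM2l (ltW a0))//; lra.
have ns : 0 <= 1 - s * s.
  have -> : 1 - s * s = (1 - s) * (1 + s) by ring.
  by apply: mulr_ge0; lra.
have b1 : - (a * (a * (1 - s * s) - 3 * s)) <= 3 * a.
  have h1 : 0 <= a * (a * (1 - s * s)) by apply: mulr_ge0 (ltW a0) (mulr_ge0 (ltW a0) ns).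
  have h2 : a * s <= a by rewrite -[leRHS]mulr1 (ler_wpM2l (ltW a0))//; lra.
  have -> : - (a * (a * (1 - s * s) - 3 * s)) = - (a * (a * (1 - s * s))) + 3 * (a * s) by ring.
  lra.
have b2 : - (ep * expR (a * s) * (a * (a * (1 - s * s) - 3 * s))) <= dl.
  rewrite -epE -mulrN; apply: (@le_trans _ _ (ep * expR (a * s) * (3 * a))).
    by apply: ler_wpM2l => //; exact: mulr_ge0 (ltW ep0) (ltW X0).
  rewrite -mulrA; apply: ler_wpM2l (ltW ep0) _ _ _; rewrite mulrC.
  by apply: ler_wpM2l => //; apply: mulr_ge0 => //; exact: ltW.
lra.
Qed.

Lemma dgauss_eq0 : (forall p, S3 p -> energy z e p = 0) ->
  forall i p w, S3 p -> dot w p = 0 -> dgauss z e i p w = 0.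
Proof.
move=> En i p w Sp wp.
have F k : dgauss z e i p (frame k p) = 0.
  have := En p Sp; rewrite /energy => /eqP; rewrite psumr_eq0; last first.
    by move=> j _; apply: sumr_ge0 => ? _; exact: sqr_ge0.
  move=> /allP/(_ i); rewrite mem_index_enum => /(_ isT)/=.
  rewrite psumr_eq0; last by move=> j _; exact: sqr_ge0.
  move=> /allP/(_ k); rewrite mem_index_enum => /(_ isT)/=.
  by rewrite sqrf_eq0 => /eqP.
rewrite (frame_expansion w Sp) wp scale0r add0r sum_I3.
(* A coefficient 1 gives the three-term sum the shape [a *: v + b *: w] required by [dgaussD]. *)
rewrite -[X in dgauss _ _ _ _ X]scale1r scale1r -[X in X + _ *: frame 2 p]scale1r.
by rewrite !dgaussD// !F; ring.
Qed.

Lemma gauss_constant : (forall p, S3 p -> energy z e p = 0) ->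
  forall i p q, S3 p -> S3 q -> gauss z e i p = gauss z e i q.
Proof.
move=> En i p q Sp Sq.
have along w t : dot w w = 1 -> dot p w = 0 -> gauss z e i (circ p w t) = gauss z e i p.
  move=> w1 pw; rewrite -[in RHS](circ0 p w).
  apply: (@is_derive_0_is_cst _ (fun s => gauss z e i (circ p w s))) => s.
  have := is_derive_gauss_circ dz e i p w s; rewrite dgauss_eq0//.
    exact: dot_circ.
  rewrite /circ !dotL (dotC w p) pw w1 Sp; ring.
pose s := dot p q; pose r := q - s *: p.
have pr : dot p r = 0 by rewrite /r !dotL Sp /s; ring.
have rr : dot r r = 1 - s * s
  by rewrite {2}/r dotDr dotNr dotZr (dotC r p) pr /r dotDl dotNl dotZl Sq -/s; ring.
have qE : q = s *: p + r by rewrite /r addrC subrK.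
(* Here q = p or q = - p, and any unit direction orthogonal to p yields a joining great circle. *)
have [r0|r0] := pselect (r = 0).
  have [w [w1 wp _]] := exists_unit_normal p 0.
  have [t [ta tb]] : exists t, cos t = s /\ sin t = 0.
    apply: cos_sin_surjective; move: rr; rewrite r0 dot0l; lra.
  rewrite -(along w t)//; last by rewrite dotC.
  by rewrite /circ ta tb scale0r addr0 qE r0 addr0.
pose m := Num.sqrt (dot r r).
have mm : m * m = dot r r by rewrite -expr2 sqr_sqrtr// dot_ge0.
have m0 : m != 0 by apply/eqP => m0; apply: r0; apply: dot_eq0; rewrite -mm m0 mulr0.
have [t [ta tb]] : exists t, cos t = s /\ sin t = m.
  by apply: cos_sin_surjective; rewrite mm rr; ring.
rewrite -(along (m^-1 *: r) t).
- by rewrite /circ ta tb scalerA divff// scale1r -qE.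
- by rewrite dotZl dotZr -mm; field.
- by rewrite dotZr pr mulr0.
Qed.

(** One part of p /\ z(p) already determines z(p): contracting it with p gives |p|^2 z - <z, p> p =
    z, which is linear in p once the part is constant. *)
Lemma hopf_of_constant_gauss : (forall p, S3 p -> energy z e p = 0) -> hopf z.
Proof.
move=> En.
have [p0 Sp0] := @S3_nonempty R.
pose g i := gauss z e i p0.
have g1 : g 0 * g 0 + g 1 * g 1 + g 2 * g 2 = 1.
  by have := gauss_norm uz e1 Sp0; rewrite sum_I3.
have [JJt JJ] := hopf_mx_complex_structure e1 g1.
exists (hopf_mx e (g 0) (g 1) (g 2)); split => //.
move=> p Sp; have [zp _] := uz Sp.
(* Restoring |p|^2 and <z, p> turns the claim into a polynomial identity. *)
have cE j : z p 0 j = dot p p * z p 0 j - dot (z p) p * p 0 j.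
  by rewrite Sp zp; ring.
have gE i : g i = wedge e i p (z p) by exact: gauss_constant.
apply: row4P; rewrite cE !mxE sum_I4 !mxE /= !gE /wedge /= !dotE;
  by case: e1 => E; rewrite ?E; ring.
Qed.

End MaximumPrinciple.

Theorem theoremC (R : realType) (z : 'rV[R]_4 -> 'rV[R]_4) :
  smooth_field z -> unit_vector_field z -> harmonic_field z ->
  integral_curves_great_circles z -> hopf z.
Proof.
move=> sz uz hz gz.
have dz x : differentiable z x by exact: (sz [::] x).
have dDz v x : differentiable (fun y => 'D_v z y) x by exact: (sz [:: v] x).
have zcirc := great_circle_flow sz uz gz.
have [e e1 He] := pairing_orientation uz zcirc dz.
have [n Hn] := gauss_hemisphere uz zcirc dz e1 He.
apply: (hopf_of_constant_gauss dz uz e1).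
exact: (energy_eq0 dz dDz uz zcirc hz e1 Hn).
Qed.
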